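(* Let $\delta>0$ be fixed and let $p=p(n)\in(0,1)$ satisfy $p\to 0$ and $n^{1/2}p\to\infty$ as $n\to\infty$. Then $$\lim_{n\to\infty}\frac{-\log \mathbb{P}\big(\lambda_1(\mathcal{G}_{n,p})\ge (1+\delta)np\big)}{n^2p^2\log(1/p)}=\min\left\{\frac{(1+\delta)^2}{2},\ \delta(1+\delta)\right\}.$$
   Context: $\mathcal{G}_{n,p}$ is the Erdős–Rényi random graph on $n$ vertices in which each of the $\binom n2$ edges is present independently with probability $p$. $\lambda_1(\mathcal{G}_{n,p})\ge\lambda_2(\mathcal{G}_{n,p})\ge\cdots\ge\lambda_n(\mathcal{G}_{n,p})$ are the eigenvalues of its $n\times n$ ($0/1$, symmetric, zero diagonal) adjacency matrix. *)

(* Defs.v *)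
From HB Require Import structures.
From mathcomp Require Import all_boot all_order all_algebra.
From mathcomp Require Import all_classical all_reals all_analysis.
Set Implicit Arguments.
Unset Strict Implicit.
Unset Printing Implicit Defensive.
Import Order.TTheory GRing.Theory Num.Theory.
Import numFieldNormedType.Exports.
Local Open Scope classical_set_scope.
Local Open Scope ring_scope.

Definition edge (n : nat) := {e : {set 'I_n} | #|e| == 2%N}.

Definition graph (n : nat) := {set edge n}.

(* The diagonal is zero: [set i; i] has one element, hence is not an edge. *)
Definition adjacency (R : realType) (n : nat) (G : graph n) : 'M[R]_n :=
  \matrix_(i, j) [exists e in G, val e == [set i; j]%SET]%:R.

(* For a real symmetric matrix of size n > 0 the set of eigenvalues is finite
   and nonempty, so that its supremum is the largest eigenvalue. *)
Definition lambda1 (R : realType) (n : nat) (A : 'M[R]_n) : R :=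
  sup [set a | eigenvalue A a].

(* Probability of an event under the law G(n, p), that is, the product over
   the possible edges of Bernoulli laws of parameter p. *)
Definition Gnp_prob (R : realType) (n : nat) (p : R) (E : pred (graph n)) : R :=
  \sum_(G : graph n | E G) \prod_(e : edge n) (if e \in G then p else 1 - p).

(* Main.v *)
(* Upper bound on the probability. The event is a union of half-spaces
   [v A v^T >= (1 + delta) n p] over unit vectors [v >= 0], which a grid of
   [exp (O (n log n))] vectors discretizes; since [n p^2] tends to infinity this
   cardinality is negligible against [exp (n^2 p^2 log (1/p))]. For a fixed [v],
   Chernoff's bound with parameter [y n p log (1/p)] reduces to the Bernoulli
   log-moment generating function, which is [p s + s^2 / (4 log (1/p))] at worst,
   and only [p s + o(s^2 / log (1/p))] for [s <= log (1/p) / 2]. Let [s], [m], [l]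
   be the masses of the coordinates of [v] that are small, comparable or large
   with respect to [(n p)^(-1/2)]. The exponent becomes
   [y (1 + delta - s) - y^2 (m^2 / 2 + l m + l s)], whose maximum over [y] is at
   least [min ((1 + delta)^2 / 2, delta (1 + delta))].
   Lower bound: plant a clique on about [(1 + delta) n p] vertices, or join about
   [delta (1 + delta) n p^2] vertices to all the others. *)
Require Import Defs.
From HB Require Import structures.
From mathcomp Require Import all_boot all_order all_algebra.
From mathcomp Require Import all_classical all_reals all_analysis.
From mathcomp Require Import ring lra.
Set Implicit Arguments.
Unset Strict Implicit.
Unset Printing Implicit Defensive.
Import Order.TTheory GRing.Theory Num.Theory.
Import numFieldNormedType.Exports.
Local Open Scope classical_set_scope.
Local Open Scope ring_scope.

(** * Rayleigh quotients *)

Definition dot (R : realType) (n : nat) (u v : 'rV[R]_n) : R := (u *m v^T) 0 0.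

Lemma dot_sum (R : realType) (n : nat) (u v : 'rV[R]_n) :
  dot u v = \sum_i u 0 i * v 0 i.
Proof. by rewrite /dot mxE; apply: eq_bigr => i _; rewrite mxE. Qed.

Lemma dotC (R : realType) (n : nat) (u v : 'rV[R]_n) : dot u v = dot v u.
Proof. by rewrite !dot_sum; apply: eq_bigr => i _; rewrite mulrC. Qed.

Lemma dotBl (R : realType) (n : nat) (u v w : 'rV[R]_n) :
  dot (u - v) w = dot u w - dot v w.
Proof. by rewrite /dot mulmxBl !mxE. Qed.

Lemma dotZl (R : realType) (n : nat) (a : R) (u v : 'rV[R]_n) :
  dot (a *: u) v = a * dot u v.
Proof. by rewrite /dot -scalemxAl mxE. Qed.

Lemma dot_mulmxl (R : realType) (n : nat) (A : 'M[R]_n) (u v : 'rV[R]_n) :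
  dot (u *m A) v = dot u (v *m A^T).
Proof. by rewrite /dot trmx_mul trmxK mulmxA. Qed.

Lemma dot_ge0 (R : realType) (n : nat) (u : 'rV[R]_n) : 0 <= dot u u.
Proof. by rewrite dot_sum sumr_ge0// => i _; rewrite -expr2 sqr_ge0. Qed.

Lemma dot_gt0 (R : realType) (n : nat) (u : 'rV[R]_n) : u != 0 -> 0 < dot u u.
Proof.
move=> u0; rewrite lt_def dot_ge0 andbT; apply: contra u0 => /eqP.
rewrite dot_sum => /psumr_eq0P uE; apply/eqP/rowP => i; rewrite mxE.
have /eqP := uE (fun j _ => eq_ind _ is_true (sqr_ge0 (u 0 j)) _
  (congr1 _ (expr2 (u 0 j)))) i isT.
by rewrite mulf_eq0 orbb => /eqP.
Qed.

(** Each [|u_i u_j|] is at most [dot u u], so the sum of the [|A i j|] is enough; the added 1 keeps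
    [C] positive when [A] vanishes. *)
Lemma dot_mulmx_bound (R : realType) (n : nat) (A : 'M[R]_n) :
  exists2 C : R, 0 < C & forall u, dot (u *m A) u <= C * dot u u.
Proof.
exists (1 + \sum_i \sum_j `|A i j|) => [|u].
  by rewrite ltr_pwDl// sumr_ge0// => i _; apply: sumr_ge0.
rewrite mulrDl mul1r -[leLHS]add0r lerD ?dot_ge0//.
have -> : dot (u *m A) u = \sum_i \sum_j u 0 i * A i j * u 0 j.
  rewrite dot_sum exchange_big /=; apply: eq_bigr => j _.
  by rewrite mxE mulr_suml.
rewrite mulr_suml ler_sum// => i _; rewrite mulr_suml ler_sum// => j _.
apply: le_trans (ler_norm _) _.
rewrite mulrAC normrM mulrC ler_wpM2l//.
have sq k : u 0 k ^+ 2 <= dot u u.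
  rewrite dot_sum (bigD1 k)//= -expr2 lerDl sumr_ge0// => l _.
  by rewrite -expr2 sqr_ge0.
have := sq i; have := sq j; rewrite -(real_normK (num_real (u 0 i))).
rewrite -(real_normK (num_real (u 0 j))) normrM.
have := sqr_ge0 (`|u 0 i| - `|u 0 j|); nra.
Qed.

(** The form of [invmx B *m (invmx B)^T] takes the value [dot u u] at [u *m B], so the previous
    bound applies to it. *)
Lemma dot_unitmx_bound (R : realType) (n : nat) (B : 'M[R]_n) :
  B \in unitmx -> exists2 C : R, 0 < C &
  forall u, dot u u <= C * dot (u *m B) (u *m B).
Proof.
move=> Bu; have [C C0 CP] := dot_mulmx_bound (invmx B *m (invmx B)^T).
exists C => // u; rewrite (le_trans _ (CP _))//.
by rewrite [u *m B *m _]mulmxA dot_mulmxl trmxK -mulmxA mulmxV// mulmx1.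
Qed.

(* The least [x] with [x%:M - A] positive semidefinite is an eigenvalue: if [M]
   is positive semidefinite and invertible, evaluating its form at [u - s u M]
   for a small [s] shows that the form dominates [|u M|^2], hence [|u|^2]. *)
Lemma eigenvalue_ge_rayleigh (R : realType) (n : nat) (A : 'M[R]_n)
    (v : 'rV[R]_n) (t : R) :
  A^T = A -> v != 0 -> t * dot v v <= dot (v *m A) v ->
  exists2 a, eigenvalue A a & t <= a.
Proof.
move=> symA v0 tv.
pose B := [set x : R | forall u, dot (u *m A) u <= x * dot u u].
have lbB u : u != 0 -> lbound B (dot (u *m A) u / dot u u).
  by move=> u0 x /(_ u); rewrite ler_pdivrMr ?dot_gt0.
have B0 : B !=set0 by have [C _ CP] := dot_mulmx_bound A; exists C.
have hB : has_lbound B by exists (dot (v *m A) v / dot v v); exact: lbB.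
have infB : B (inf B).
  move=> u; have [->|u0] := eqVneq u 0; first by rewrite /dot !mul0mx !mxE mulr0.
  rewrite -ler_pdivrMr ?dot_gt0//; apply: lb_le_inf => //; exact: lbB.
exists (inf B); last first.
  by apply: lb_le_inf => // x /(_ v) /(le_trans tv); rewrite ler_pM2r ?dot_gt0.
apply: contrapT => /negP/negPn Ex.
set M := (inf B)%:M - A.
have Mu : M \in unitmx.
  rewrite -row_free_unit -kermx_eq0; move/eqP: Ex; rewrite /eigenspace => Ex.
  have -> : M = - (A - (inf B)%:M) by rewrite opprB.
  apply/rowV0P => w /sub_kermxP; rewrite mulmxN => /eqP; rewrite oppr_eq0.
  by move=> /eqP /sub_kermxP; rewrite Ex submx0 => /eqP.
have symM : M^T = M by rewrite /M linearB /= tr_scalar_mx symA.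
have ME u : dot (u *m M) u = inf B * dot u u - dot (u *m A) u.
  by rewrite /M mulmxBr dotBl mul_mx_scalar dotZl.
have psd u : 0 <= dot (u *m M) u by rewrite ME subr_ge0; apply: infB.
have [C C0 CP] := dot_mulmx_bound M.
have [D D0 DP] := dot_unitmx_bound Mu.
have key u : (C * D)^-1 * dot u u <= dot (u *m M) u.
  (* The step [C^-1] makes the quadratic term of the expansion at most [C^-1 * dot w w], half of
     what the linear term removes; there remains [C^-1 * dot w w <= dot w u]. *)
  have /= := psd (u - C^-1 *: (u *m M)).
  set w := u *m M.
  have -> : dot ((u - C^-1 *: w) *m M) (u - C^-1 *: w) =
      dot w u - 2 * C^-1 * dot w w + C^-1 ^+ 2 * dot (w *m M) w.
    rewrite mulmxBl dotBl -scalemxAl dotZl -/w ![dot _ (u - _)]dotC !dotBl !dotZl.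
    rewrite [dot u w]dotC [dot u (w *m M)]dotC [dot (w *m M) u]dot_mulmxl symM -/w.
    rewrite [dot w (w *m M)]dotC; ring.
  have := CP w; have := DP u; rewrite -/w => h1 h2.
  have C'0 : 0 < C^-1 by rewrite invr_gt0.
  have CC : C * C^-1 = 1 by rewrite mulfV ?gt_eqF.
  have h3 : C^-1 ^+ 2 * dot (w *m M) w <= C^-1 * dot w w.
    apply: le_trans (ler_wpM2l (sqr_ge0 _) h2) _.
    by rewrite expr2 mulrA -[_ * C]mulrA [C^-1 * C]mulrC CC mulr1.
  have h4 : (C * D)^-1 * dot u u <= C^-1 * dot w w.
    by rewrite invfM -mulrA ler_wpM2l ?(ltW C'0)// ler_pdivrMl.
  lra.
have : B (inf B - (C * D)^-1).
  by move=> u; have := key u; rewrite ME mulrBl; lra.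
move=> /(ge_inf hB); have : 0 < (C * D)^-1 by rewrite invr_gt0 mulr_gt0.
lra.
Qed.

Lemma eigenvalue_bounded (R : realType) (n : nat) (A : 'M[R]_n) :
  has_ubound [set a | eigenvalue A a].
Proof.
have [C _ CP] := dot_mulmx_bound A; exists C => a /eigenvalueP[v va v0].
by have := CP v; rewrite va dotZl ler_pM2r ?dot_gt0.
Qed.

Lemma rayleigh_le_lambda1 (R : realType) (n : nat) (A : 'M[R]_n)
    (v : 'rV[R]_n) (t : R) :
  A^T = A -> v != 0 -> t * dot v v <= dot (v *m A) v -> t <= lambda1 A.
Proof.
move=> symA v0 /(eigenvalue_ge_rayleigh symA v0)[a Aa ta].
apply: le_trans ta _; exact: (ub_le_sup (eigenvalue_bounded A) Aa).
Qed.

(** The supremum is only approached within 1, which is harmless at the scale [n p]. The hypothesis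
    [0 < t] excludes the default value 0 of [sup] on a set without supremum. *)
Lemma rayleigh_of_lambda1 (R : realType) (n : nat) (A : 'M[R]_n) (t : R) :
  0 < t -> t <= lambda1 A -> exists2 v : 'rV[R]_n, v != 0 &
  (t - 1) * dot v v <= dot (v *m A) v.
Proof.
move=> t0 tA.
have hs : has_sup [set a | eigenvalue A a].
  by apply: contrapT => /sup_out h; move: tA; rewrite /lambda1 h leNgt t0.
have [a /eigenvalueP[v va v0] ta] := sup_adherent (@ltr01 R) hs.
exists v => //; rewrite va dotZl ler_wpM2r ?dot_ge0// ltW//.
by apply: le_lt_trans ta; rewrite lerD2r.
Qed.

(** * Adjacency matrices and edges *)

(** Both orientations of the edge contribute, so that no orientation is chosen and a quadratic form
    becomes a sum over edges. *)
Definition edge_sum (R : realType) (n : nat) (F : 'I_n -> 'I_n -> R)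
    (e : edge n) : R :=
  \sum_(ij : 'I_n * 'I_n | val e == [set ij.1; ij.2]%SET) F ij.1 ij.2.

Lemma edgeP (n : nat) (e : edge n) :
  exists i j : 'I_n, i != j /\ val e = [set i; j]%SET.
Proof. by have /cards2P := valP e. Qed.

Lemma edge_of_pair (n : nat) (i j : 'I_n) : i != j ->
  exists e : edge n, val e = [set i; j]%SET.
Proof.
move=> ij; have e2 : #|[set i; j]%SET| == 2%N by rewrite cards2 ij.
by exists (Sub [set i; j]%SET e2); rewrite SubK.
Qed.

Lemma edge_sumE (R : realType) (n : nat) (F : 'I_n -> 'I_n -> R) (e : edge n)
    (i j : 'I_n) :
  i != j -> val e = [set i; j]%SET -> edge_sum F e = F i j + F j i.
Proof.
move=> ij eij; rewrite /edge_sum (bigD1 (i, j)) ?eij//=.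
rewrite (bigD1 (j, i)) /=; last first.
  by rewrite [X in X == _]finset.setUC eqxx xpair_eqE negb_and eq_sym ij.
rewrite big1 ?addr0// => -[k l] /= /andP[/andP[/eqP kl k1 ] k2].
have : k \in [set i; j]%SET by rewrite kl !inE eqxx.
have : l \in [set i; j]%SET by rewrite kl !inE eqxx orbT.
have : i \in [set k; l]%SET by rewrite -kl !inE eqxx.
have : j \in [set k; l]%SET by rewrite -kl !inE eqxx orbT.
move=> jkl ikl /set2P[] El /set2P[] Ek; move: jkl ikl k1 k2;
  by rewrite El Ek !inE ?eqxx// ?[j == i]eq_sym (negPf ij).
Qed.

Lemma sum_edge_sum (R : realType) (n : nat) (F : 'I_n -> 'I_n -> R) :
  \sum_(e : edge n) edge_sum F e = \sum_i \sum_(j | i != j) F i j.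
Proof.
rewrite [RHS]pair_big_dep /=.
transitivity (\sum_(e : edge n) \sum_(ij : 'I_n * 'I_n)
    if val e == [set ij.1; ij.2]%SET then F ij.1 ij.2 else 0).
  by apply: eq_bigr => e _; rewrite /edge_sum big_mkcond.
rewrite exchange_big /= [RHS]big_mkcond /=; apply: eq_bigr => -[i j] _ /=.
rewrite -big_mkcond /=; have [eij|ij] := eqVneq i j.
  rewrite big1// => e /eqP eE; have := valP e.
  by rewrite /= eE eij cards2 eqxx.
have [e eE] := edge_of_pair ij.
rewrite (big_pred1 e)// => f /=; rewrite -eE.
by rewrite (inj_eq val_inj).
Qed.

Lemma adjacencyE (R : realType) (n : nat) (G : graph n) (i j : 'I_n)
    (e : edge n) :
  val e = [set i; j]%SET -> adjacency R G i j = (e \in G)%:R.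
Proof.
move=> eij; rewrite mxE; congr (nat_of_bool _)%:R.
apply/existsP/idP => [[f /andP[fG /eqP fE]]|eG]; last first.
  by exists e; rewrite eG eij eqxx.
by have -> : e = f by apply: val_inj; rewrite eij fE.
Qed.

Lemma adjacency_diag (R : realType) (n : nat) (G : graph n) (i : 'I_n) :
  adjacency R G i i = 0.
Proof.
rewrite mxE; case: existsP => // -[e /andP[_ /eqP eE]].
by have := valP e; rewrite /= eE cards2 eqxx.
Qed.

Lemma adjacency_sym (R : realType) (n : nat) (G : graph n) :
  (adjacency R G)^T = adjacency R G.
Proof. by apply/matrixP => i j; rewrite !mxE finset.setUC. Qed.

Lemma adjacency_ge0 (R : realType) (n : nat) (G : graph n) (i j : 'I_n) :
  0 <= adjacency R G i j <= 1.
Proof. by rewrite mxE; case: existsP => _; rewrite ?ler01 lexx. Qed.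

Lemma quad_form_sum (R : realType) (n : nat) (A : 'M[R]_n) (v : 'rV[R]_n) :
  dot (v *m A) v = \sum_i \sum_j v 0 i * A i j * v 0 j.
Proof.
rewrite dot_sum exchange_big /=; apply: eq_bigr => j _.
by rewrite mxE mulr_suml.
Qed.

Lemma adjacency_quad_form (R : realType) (n : nat) (G : graph n)
    (x : 'I_n -> R) :
  \sum_i \sum_j x i * adjacency R G i j * x j =
  \sum_(e in G) edge_sum (fun i j => x i * x j) e.
Proof.
rewrite [RHS]big_mkcond /=.
transitivity (\sum_(e : edge n)
    edge_sum (fun i j => x i * adjacency R G i j * x j) e).
  rewrite sum_edge_sum; apply: eq_bigr => i _; rewrite [RHS]big_mkcond /=.
  apply: eq_bigr => j _; case: eqVneq => //= ->.
  by rewrite adjacency_diag mulr0 mul0r.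
apply: eq_bigr => e _; have [i [j [ij eij]]] := edgeP e.
rewrite !(edge_sumE _ ij eij) (adjacencyE _ _ eij).
have eji : val e = [set j; i]%SET by rewrite finset.setUC.
rewrite (adjacencyE _ _ eji); case: (e \in G); rewrite !(mulr0, mul0r, mulr1)//.
by rewrite addr0.
Qed.

(** * Exponential moments under G(n, p) *)

Definition Gnp_weight (R : realType) (n : nat) (p : R) (G : graph n) : R :=
  \prod_(e : edge n) (if e \in G then p else 1 - p).

Lemma Gnp_weight_ge0 (R : realType) (n : nat) (p : R) (G : graph n) :
  0 < p < 1 -> 0 <= Gnp_weight p G.
Proof.
move=> /andP[p0 p1]; apply: prodr_ge0 => e _.
by case: ifP => _; rewrite ?subr_ge0 ltW.
Qed.

(** Independence of the edges, obtained by expanding the product on the right over all sets of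
    edges. Every moment computation below goes through it. *)
Lemma Gnp_expectation_prod (R : realType) (n : nat) (p : R)
    (f g : edge n -> R) :
  \sum_(G : graph n) Gnp_weight p G * \prod_e (if e \in G then f e else g e) =
  \prod_e (p * f e + (1 - p) * g e).
Proof.
rewrite bigA_distr; apply: eq_bigr => G _; rewrite -big_split /=.
by apply: eq_bigr => e _; case: ifP.
Qed.

Lemma le_Gnp_prob (R : realType) (n : nat) (p : R) (E E' : pred (graph n)) :
  0 < p < 1 -> (forall G, E G -> E' G) -> Gnp_prob p E <= Gnp_prob p E'.
Proof.
move=> p01 EE'; rewrite /Gnp_prob big_mkcond [leRHS]big_mkcond /=.
apply: ler_sum => G _; have := Gnp_weight_ge0 G p01; rewrite /Gnp_weight => w0.
by case: ifP => [/EE' ->//|_]; case: ifP.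
Qed.

Lemma Gnp_prob_union (R : realType) (n : nat) (p : R) (I : finType)
    (P : pred I) (E : I -> pred (graph n)) :
  0 < p < 1 ->
  Gnp_prob p (fun G => [exists i, P i && E i G]) <=
  \sum_(i | P i) Gnp_prob p (E i).
Proof.
move=> p01; rewrite /Gnp_prob.
rewrite [leRHS](exchange_big_dep predT)//= big_mkcond /=.
apply: ler_sum => G _; have := Gnp_weight_ge0 G p01; rewrite /Gnp_weight => w0.
case: existsP => [[i iE]|_]; last by rewrite sumr_ge0.
by rewrite (bigD1 i iE) /= lerDl sumr_ge0.
Qed.

(** Exponential Markov inequality: the indicator of the event is at most [exp (theta (X - t))],
    where [X] is the weighted sum, and its expectation factors. *)
Lemma Gnp_chernoff (R : realType) (n : nat) (p theta t : R)
    (w : edge n -> R) :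
  0 < p < 1 -> 0 <= theta ->
  Gnp_prob p (fun G : graph n => t <= \sum_(e in G) w e) <=
  expR (- (theta * t)) * \prod_e (1 + p * (expR (theta * w e) - 1)).
Proof.
move=> p01 th0; rewrite /Gnp_prob big_mkcond /=.
have -> : \prod_e (1 + p * (expR (theta * w e) - 1)) =
    \prod_e (p * expR (theta * w e) + (1 - p) * 1).
  by apply: eq_bigr => e _; ring.
rewrite -Gnp_expectation_prod mulr_sumr; apply: ler_sum => G _.
have w0 := Gnp_weight_ge0 G p01.
have -> : \prod_e (if e \in G then expR (theta * w e) else 1) =
    expR (theta * \sum_(e in G) w e).
  by rewrite -big_mkcond /= mulr_sumr expR_sum.
rewrite mulrCA -expRD; case: ifP => [tG|_]; last by rewrite mulr_ge0 ?expR_ge0.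
rewrite -[leLHS]mulr1 ler_wpM2l// -expR0 ler_expR.
by rewrite addrC subr_ge0 ler_wpM2l.
Qed.

(** The indicator of the event is a product over edges, with the factor 0 at an absent edge of
    [H]. *)
Lemma Gnp_prob_supset (R : realType) (n : nat) (p : R) (H : {set edge n}) :
  Gnp_prob p (fun G : graph n => H \subset G) = p ^+ #|H|.
Proof.
have -> : Gnp_prob p (fun G : graph n => H \subset G) =
   \sum_(G : graph n) Gnp_weight p G *
     \prod_e (if e \in G then 1 else (e \notin H)%:R).
  rewrite /Gnp_prob big_mkcond /=; apply: eq_bigr => G _.
  case: ifPn => [/fintype.subsetP HG|/fintype.subsetPn[e eH eG]].
    rewrite [X in _ * X]big1 ?mulr1// => e _; case: ifPn => // /negP eG.
    by rewrite (introN idP (fun eH => eG (HG e eH))).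
  by rewrite (bigD1 e)//= (negPf eG) eH mul0r mulr0.
rewrite Gnp_expectation_prod -prodr_const [RHS]big_mkcond /=.
by apply: eq_bigr => e _; case: (e \in H); rewrite /= ?mulr0; ring.
Qed.

(** As [H] and [W] are disjoint, forcing [H] leaves the edges of [W] independent, and Chernoff's
    lower tail bound holds for them with [p ^+ #|H|] in front. In use, [H] joins the hub to the
    other vertices and [W] lies away from the hub. *)
Lemma Gnp_lower_tail (R : realType) (n : nat) (p ep : R)
    (H W : {set edge n}) :
  0 < p < 1 -> 0 < ep -> (forall e, e \in H -> e \notin W) ->
  p ^+ #|H| * (1 - expR (- (ep ^+ 2 * p * #|W|%:R / 4))) <=
  Gnp_prob p (fun G : graph n =>
    (H \subset G) && ((1 - ep) * p * #|W|%:R <= #|G :&: W|%:R)).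
Proof.
(* The exponent is [p #|W| (th^2 - ep th)], which is least at [th = ep / 2]; hence the denominator
   4. *)
move=> p01 ep0 HW; set T := (1 - ep) * p * _; set th := ep / 2.
have th0 : 0 < th by rewrite divr_gt0.
pose Y := Gnp_prob p (fun G : graph n =>
    (H \subset G) && (#|G :&: W|%:R < T)).
have split : Gnp_prob p (fun G : graph n => H \subset G) = Y +
    Gnp_prob p (fun G : graph n => (H \subset G) && (T <= #|G :&: W|%:R)).
  rewrite /Y /Gnp_prob (bigID (fun G : graph n => #|G :&: W|%:R < T)) /=.
  congr (_ + _); apply: eq_bigl => G; by rewrite -leNgt.
suff YH : Y <= p ^+ #|H| * expR (- (ep ^+ 2 * p * #|W|%:R / 4)).
  by rewrite mulrBr mulr1 lerBlDr -{1}Gnp_prob_supset split addrC lerD2l.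
have: Y <= expR (th * T) * \sum_(G : graph n) Gnp_weight p G *
    \prod_e (if e \in G then (if e \in W then expR (- th) else 1)
             else (e \notin H)%:R).
  rewrite /Y /Gnp_prob big_mkcond /= mulr_sumr; apply: ler_sum => G _.
  have w0 := Gnp_weight_ge0 G p01; rewrite mulrCA.
  case: ifPn => [/andP[/fintype.subsetP HG GW]|_]; last first.
    rewrite !mulr_ge0 ?expR_ge0// prodr_ge0// => e _.
    by case: ifP => _; rewrite ?ler0n//; case: ifP => _; rewrite ?expR_ge0.
  rewrite -[leLHS]mulr1 ler_wpM2l//.
  have -> : \prod_e (if e \in G then (if e \in W then expR (- th) else 1)
             else (e \notin H)%:R) = expR (- th * #|G :&: W|%:R).
    rewrite mulrC expRM_natl -prodr_const [RHS]big_mkcond /=.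
    apply: eq_bigr => e _; rewrite inE; case: ifPn => //= /negP eG.
    by rewrite (introN idP (fun eH => eG (HG e eH))).
  rewrite -expRD mulNr -mulrBr -[leLHS]expR0 ler_expR.
  by rewrite mulr_ge0 ?subr_ge0 ?(ltW th0) ?(ltW GW).
move/le_trans; apply; rewrite Gnp_expectation_prod.
have -> : \prod_e (p * (if e \in W then expR (- th) else 1) +
      (1 - p) * (e \notin H)%:R) =
    p ^+ #|H| * (1 + p * (expR (- th) - 1)) ^+ #|W|.
  rewrite -!prodr_const [X in X * _]big_mkcond [X in _ * X]big_mkcond /=.
  rewrite -big_split /=; apply: eq_bigr => e _.
  case: ifPn => eW; case: ifPn => eH /=; rewrite ?mulr0; try ring.
  by have := HW e eH; rewrite eW.
have /andP[p0 p1] := p01.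
rewrite [leLHS]mulrCA; apply: ler_wpM2l; first exact: exprn_ge0 (ltW p0).
(* This rests on [exp (- th) <= 1 / (1 + th) <= 1 - th + th^2]. *)
have step : 1 + p * (expR (- th) - 1) <= expR (- (p * (th - th ^+ 2))).
  apply: le_trans (expR_ge1Dx _); rewrite lerD2l -[leRHS]mulrN ler_wpM2l ?(ltW p0)//.
  rewrite expRN; have : (expR th)^-1 <= (1 + th)^-1.
    by rewrite lef_pV2 ?posrE ?expR_gt0 ?expR_ge1Dx// addr_gt0.
  have : (1 + th)^-1 * (1 + th) = 1 by rewrite mulVf// gt_eqF// addr_gt0.
  nra.
have step0 : 0 <= 1 + p * (expR (- th) - 1).
  have := expR_ge0 (- th); nra.
apply: le_trans (ler_wpM2l (expR_ge0 _) (lerXn2r _ _ _ step)) _.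
- by rewrite nnegrE.
- by rewrite nnegrE expR_ge0.
rewrite -expRM_natl -expRD ler_expR /T /th -[in leLHS]mulr_natl.
set N := #|W|%:R; nra.
Qed.

(** * The variational problem *)

(** One has [e^s - 1 <= s + s^2 e^s], and [e^(s - L) <= e^(- L / 2) <= ep / L] because
    [e^(L / 2) >= L^2 / 8] and [8 <= ep L]. *)
Lemma bernoulli_mgf_small (R : realType) (L ep s : R) :
  0 < ep -> 8 / ep <= L -> 0 <= s -> s <= L / 2 ->
  1 + expR (- L) * (expR s - 1) <= expR (expR (- L) * s + ep * (s ^+ 2 / L)).
Proof.
move=> ep0 epL s0 sL.
have L0 : 0 < L by apply: lt_le_trans epL; rewrite divr_gt0.
apply: le_trans (expR_ge1Dx _); rewrite lerD2l.
have h1 : expR s - 1 <= s + s ^+ 2 * expR s.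
  have : 1 - s <= expR (- s) by exact: expR_ge1Dx.
  have : expR (- s) * expR s = 1 by rewrite -expRD addNr expR0.
  have := expR_gt0 s; have := expR_gt0 (- s); nra.
apply: le_trans (ler_wpM2l (expR_ge0 _) h1) _.
rewrite mulrDr lerD2l mulrCA [leRHS]mulrCA ler_wpM2l ?sqr_ge0//.
rewrite -expRD; apply: (@le_trans _ _ (expR (- (L / 2)))).
  by rewrite ler_expR; lra.
have L20 : 0 <= L / 2 by rewrite divr_ge0// ltW.
have := expR_ge1Dxn 1 L20; rewrite (_ : 2`!%:R = 2)// => h2.
rewrite expRN ler_pdivlMr//.
have e0 := expR_gt0 (L / 2); rewrite mulrC ler_pdivrMr//.
have : 8 <= L * ep by rewrite -ler_pdivrMr.
nra.
Qed.

(* The worst case is [s = 2 L]: the inequality [s - L <= s^2 / (4 L)] is an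
   equality there. *)
Lemma bernoulli_mgf_quad (R : realType) (L ep s : R) :
  0 < ep -> 8 / ep <= L -> 32 <= L -> 0 <= s ->
  1 + expR (- L) * (expR s - 1) <=
  expR (expR (- L) * s + (1 + ep) * (s ^+ 2 / L) / 4).
Proof.
move=> ep0 epL L32 s0.
have L0 : 0 < L by apply: lt_le_trans L32.
have sL0 : 0 <= s ^+ 2 / L by rewrite divr_ge0 ?sqr_ge0 ?ltW.
have [sL|sL] := leP s (L / 2).
  (* The small regime is applied with [1 / 4] in place of [ep], for which the condition on [L] reads
     [32 <= L]. *)
  have q0 : 0 < (4^-1 : R) by lra.
  have qL : 8 / 4^-1 <= L by lra.
  apply: le_trans (bernoulli_mgf_small q0 qL s0 sL) _.
  by rewrite ler_expR lerD2l; nra.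
have Ls0 : 0 <= expR (- L) * s by rewrite mulr_ge0 ?expR_ge0.
apply: (@le_trans _ _ (expR ((1 + ep) * (s ^+ 2 / L) / 4))); last first.
  by rewrite ler_expR lerDr.
have e2 : 2 <= expR 1 :> R by have := expR_ge1Dx (1 : R); lra.
have h1 : 1 + expR (- L) * (expR s - 1) <= 1 + expR (s - L).
  by rewrite lerD2l mulrBr mulr1 -expRD [- L + s]addrC gerBl expR_ge0.
apply: le_trans h1 _.
have sLE : s ^+ 2 / L * L = s ^+ 2 by rewrite divfK// gt_eqF.
have epL' : 8 <= L * ep by rewrite -ler_pdivrMr.
have [sL'|sL'] := leP s L.
  apply: (@le_trans _ _ (expR 1)).
    have : expR (s - L) <= 1 by rewrite -[leRHS]expR0 ler_expR; lra.
    by move=> ?; lra.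
  rewrite ler_expR.
  have : L / 4 <= s ^+ 2 / L by nra.
  nra.
(* Here [1 + e^(s - L)] is at most [2 e^(s - L)]; the constant 2 is absorbed by
   [ep s^2 / (4 L) >= 1]. *)
apply: (@le_trans _ _ (expR 1 * expR (s - L))).
  have : 1 <= expR (s - L) by rewrite -[leLHS]expR0 ler_expR; lra.
  nra.
rewrite -expRD ler_expR.
have : s - L <= (s ^+ 2 / L) / 4.
  rewrite -(ler_pM2r L0) mulrAC sLE; have := sqr_ge0 (s - 2 * L); nra.
have : 1 <= ep * (s ^+ 2 / L) / 4.
  have : L <= s ^+ 2 / L by nra.
  nra.
lra.
Qed.

Lemma bernoulli_mgf_le (R : realType) (q s : R) :
  0 <= q <= 1 -> 0 <= s -> 1 + q * (expR s - 1) <= expR s.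
Proof.
move=> /andP[q0 q1] s0.
have : 1 <= expR s by rewrite -[leLHS]expR0 ler_expR.
nra.
Qed.

Lemma sqr_sum_le (R : realType) (n : nat) (f : 'I_n -> R) :
  (\sum_i f i) ^+ 2 <= n%:R * \sum_i f i ^+ 2.
Proof.
rewrite expr2 mulr_suml.
have -> : n%:R * \sum_i f i ^+ 2 =
    \sum_(i < n) \sum_(j < n) (f i ^+ 2 + f j ^+ 2) / 2.
  under [RHS]eq_bigr do rewrite -mulr_suml big_split /= sumr_const card_ord.
  rewrite -mulr_suml big_split /= sumr_const card_ord.
  by rewrite sumrMnl mulr_natl; move: (_ *+ n) => y; lra.
apply: ler_sum => i _; rewrite mulr_sumr; apply: ler_sum => j _.
have := sqr_ge0 (f i - f j); lra.
Qed.

(* With mass [s], [m], [l] on the flat, intermediate and peaked coordinates,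
   [c] is attained at [m = 1] (clique) and at [s = (1 + delta) / (1 + 2 delta)],
   [l = 1 - s] (hub). *)
Lemma variational_bound (R : realType) (delta c s m l : R) :
  0 < delta -> 0 <= c -> c <= (1 + delta) ^+ 2 / 2 -> c <= delta * (1 + delta) ->
  0 <= s -> 0 <= m -> 0 <= l -> s + m + l <= 1 ->
  4 * c * (m ^+ 2 / 2 + l * m + l * s) <= (1 + delta - s) ^+ 2.
Proof.
move=> d0 c0 c1 c2 s0 m0 l0 sml.
set k := 1 - s - m; have lk : l <= k by rewrite /k; lra.
have k0 : 0 <= k by apply: le_trans lk.
apply: (@le_trans _ _ (4 * c * (m ^+ 2 / 2 + k * m + k * s))).
  have -> : m ^+ 2 / 2 + k * m + k * s = m ^+ 2 / 2 + l * m + l * s +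
    (k - l) * (m + s) by ring.
  rewrite ler_wpM2l ?mulr_ge0// lerDl mulr_ge0 ?subr_ge0 ?addr_ge0//.
have -> : 4 * c * (m ^+ 2 / 2 + k * m + k * s) =
   2 * c * m ^+ 2 + 4 * c * (k * (1 - k)) by rewrite /k; field.
have -> : 1 + delta - s = delta + k + m by rewrite /k; ring.
have m1k : m <= 1 - k by rewrite /k; lra.
have k1 : 0 <= k * (1 - k) by rewrite mulr_ge0// subr_ge0 /k; lra.
(* This is the case [m = 0]. At [c = delta (1 + delta)] the difference is the square of
   [delta - (1 + 2 delta) k]. *)
have hub : 4 * c * (k * (1 - k)) <= (delta + k) ^+ 2.
  apply: (@le_trans _ _ (4 * (delta * (1 + delta)) * (k * (1 - k)))).
    by rewrite ler_wpM2r// ler_pM2l.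
  have := sqr_ge0 (delta - (1 + 2 * delta) * k); lra.
have [c12|c12] := leP (2 * c) 1.
  apply: le_trans (lerD (ler_wpM2r (sqr_ge0 m) c12) hub) _.
  have : 0 <= m * (delta + k) by rewrite mulr_ge0// addr_ge0// ltW.
  lra.
(* This is the other extreme case, [m = 1 - k], that is [s = 0]. *)
have clique : 2 * c * (1 - k ^+ 2) <= (1 + delta) ^+ 2.
  have := sqr_ge0 k; nra.
have [k_eq1|k_neq1] := eqVneq k 1.
  have -> : m = 0 by apply/eqP; rewrite eq_le m0 andbT; lra.
  by move: hub; rewrite k_eq1 expr0n /= !mulr0 add0r addr0.
have k_lt1 : 0 < 1 - k.
  by rewrite subr_gt0 lt_neqAle k_neq1 /=; lra.
rewrite -subr_ge0 -(pmulr_rge0 _ k_lt1).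
(* For [1 < 2 c] the difference is concave in [m], so on [[0, 1 - k]] it lies above its chord, whose
   endpoint values are nonnegative by [hub] and [clique]. The identity is this interpolation
   multiplied by [1 - k]. *)
have -> : (1 - k) * ((delta + k + m) ^+ 2 -
    (2 * c * m ^+ 2 + 4 * c * (k * (1 - k)))) =
  (1 - k - m) * ((delta + k) ^+ 2 - 4 * c * (k * (1 - k))) +
  m * ((1 + delta) ^+ 2 - 2 * c * (1 - k ^+ 2)) +
  (2 * c - 1) * (m * (1 - k - m) * (1 - k)) by ring.
by rewrite !addr_ge0// !mulr_ge0// ?subr_ge0// ?(ltW k_lt1)//;
  rewrite ?(ltW c12)//; lra.
Qed.

(** * Half-spaces *)

(** In use [r ^+ 2] is [n p], so coordinates are measured in units of [(n p)^(-1/2)]. *)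
Definition flat (R : realType) (n : nat) (r kappa : R) (v : 'I_n -> R)
  (i : 'I_n) : bool := r * v i <= kappa.

Definition peak (R : realType) (n : nat) (r K : R) (v : 'I_n -> R)
  (i : 'I_n) : bool := K < r * v i.

Definition middle (R : realType) (n : nat) (r kappa K : R) (v : 'I_n -> R)
  (i : 'I_n) : bool := ~~ flat r kappa v i && ~~ peak r K v i.

(* Cauchy-Schwarz on the flat part; a non-flat coordinate [x] satisfies
   [x <= (r / kappa) x^2]. *)
Lemma sum_sqr_flat (R : realType) (n : nat) (r kappa eta : R)
    (v : 'I_n -> R) :
  0 < r -> 0 < kappa -> 0 < eta -> (forall i, 0 <= v i) ->
  \sum_i v i ^+ 2 <= 1 ->
  (\sum_i v i) ^+ 2 <=
  (1 + eta) * n%:R * (\sum_i (flat r kappa v i)%:R * v i ^+ 2) +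
  (1 + eta^-1) * (r / kappa) ^+ 2.
Proof.
move=> r0 k0 e0 v0 v1.
set x := \sum_i (flat r kappa v i)%:R * v i.
set y := \sum_i (~~ flat r kappa v i)%:R * v i.
have -> : \sum_i v i = x + y.
  rewrite /x /y -big_split /=; apply: eq_bigr => i _.
  by case: flat; rewrite /= ?mul0r ?mul1r ?addr0 ?add0r.
have hx : x ^+ 2 <= n%:R * (\sum_i (flat r kappa v i)%:R * v i ^+ 2).
  apply: le_trans (sqr_sum_le _) _; rewrite ler_wpM2l// ler_sum// => i _.
  by case: flat; rewrite /= ?mul0r ?mul1r// expr0n.
have rk : 0 < r / kappa by rewrite divr_gt0.
have hy : y <= r / kappa.
  rewrite -[leRHS]mulr1; apply: le_trans (ler_wpM2l (ltW rk) v1).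
  rewrite mulr_sumr ler_sum// => i _; rewrite /flat.
  case: (leP (r * v i)) => /= h; first by rewrite mul0r mulr_ge0 ?sqr_ge0 ?(ltW rk).
  rewrite mul1r expr2 mulrA ler_peMl// mulrAC ler_pdivlMr// mul1r.
  exact: ltW.
have y0 : 0 <= y by apply: sumr_ge0 => i _; rewrite mulr_ge0.
have hy2 : y ^+ 2 <= (r / kappa) ^+ 2 by rewrite ler_sqr ?nnegrE// ltW.
have ei0 : 0 < eta^-1 by rewrite invr_gt0.
have -> : (x + y) ^+ 2 = x ^+ 2 + 2 * x * y + y ^+ 2 by ring.
have xy : 2 * x * y <= eta * x ^+ 2 + eta^-1 * y ^+ 2.
  have ee : eta * eta^-1 = 1 by rewrite mulfV ?gt_eqF.
  have := mulr_ge0 (ltW ei0) (sqr_ge0 (eta * x - y)).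
  have -> : eta^-1 * (eta * x - y) ^+ 2 =
    (eta * eta^-1) * (eta * x ^+ 2) - 2 * (eta * eta^-1) * x * y + eta^-1 * y ^+ 2.
    ring.
  by rewrite ee; lra.
have h1 : (1 + eta) * x ^+ 2 <= (1 + eta) *
  (n%:R * (\sum_i (flat r kappa v i)%:R * v i ^+ 2)).
  by rewrite ler_wpM2l// addr_ge0// ltW.
have h2 : (1 + eta^-1) * y ^+ 2 <= (1 + eta^-1) * (r / kappa) ^+ 2.
  by rewrite ler_wpM2l// addr_ge0// ltW.
rewrite -mulrA; lra.
Qed.

(** A peaked coordinate [x] satisfies [x <= (r / K) x^2]. For large [K] this makes the trivial bound
    on peak-peak pairs affordable. *)
Lemma sum_peak (R : realType) (n : nat) (r K : R) (v : 'I_n -> R) :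
  0 < r -> 0 < K -> (forall i, 0 <= v i) -> \sum_i v i ^+ 2 <= 1 ->
  (\sum_i (peak r K v i)%:R * v i) ^+ 2 <= (r / K) ^+ 2.
Proof.
move=> r0 K0 v0 v1; have rK : 0 < r / K by rewrite divr_gt0.
rewrite ler_sqr ?nnegrE ?(ltW rK)//; last first.
  by apply: sumr_ge0 => i _; rewrite mulr_ge0.
rewrite -[leRHS]mulr1; apply: le_trans (ler_wpM2l (ltW rK) v1).
rewrite mulr_sumr ler_sum// => i _; rewrite /peak.
case: (ltP K) => /= h; last by rewrite mul0r mulr_ge0 ?sqr_ge0 ?(ltW rK).
rewrite mul1r expr2 mulrA ler_peMl// mulrAC ler_pdivlMr// mul1r.
exact: ltW.
Qed.

(* Half of a bound for the log-moment generating function of the edge [i j]: a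
   peak-peak pair is charged its trivial bound (there are few of them), pairs
   flat-flat and flat-middle are in the small regime, and the other ones are
   charged the quadratic bound. *)
Definition pair_cost (R : realType) (n : nat) (L ep r kappa K theta : R)
    (v : 'I_n -> R) (i j : 'I_n) : R :=
  let S i := (flat r kappa v i)%:R * v i ^+ 2 in
  let M i := (middle r kappa K v i)%:R * v i ^+ 2 in
  let P i := (peak r K v i)%:R * v i ^+ 2 in
  expR (- L) * theta * (v i * v j) +
  2 * ep * (theta ^+ 2 / L) * (v i ^+ 2 * v j ^+ 2) +
  theta * (((peak r K v i)%:R * v i) * ((peak r K v j)%:R * v j)) +
  (1 + ep) * (theta ^+ 2 / L) / 2 *
    (M i * M j + (P i * M j + M i * P j) + (P i * S j + S i * P j)).

(** Each pair of classes gets one of the three Bernoulli bounds. The factors 2 account for the two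
    orientations of the edge. *)
Lemma edge_mgf_bound (R : realType) (n : nat) (L ep r kappa K theta : R)
    (v : 'I_n -> R) (i j : 'I_n) :
  0 < ep -> 8 / ep <= L -> 32 <= L -> 0 < r -> 0 < kappa -> kappa <= K ->
  0 <= theta -> theta * (kappa * K) <= r ^+ 2 * (L / 4) ->
  (forall i, 0 <= v i) ->
  1 + expR (- L) * (expR (theta * (2 * (v i * v j))) - 1) <=
  expR (2 * pair_cost L ep r kappa K theta v i j).
Proof.
move=> ep0 epL L32 r0 k0 kK th0 thK v0.
have L0 : 0 < L by lra.
set s := theta * (2 * (v i * v j)).
have w0 : 0 <= v i * v j by rewrite mulr_ge0.
have s0 : 0 <= s by rewrite !mulr_ge0.
have sE : s ^+ 2 / L = 4 * (theta ^+ 2 / L) * (v i ^+ 2 * v j ^+ 2).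
  by rewrite /s; ring.
have T0 : 0 <= theta ^+ 2 / L by rewrite divr_ge0 ?sqr_ge0 ?ltW.
have X0 : 0 <= theta ^+ 2 / L * (v i ^+ 2 * v j ^+ 2).
  by rewrite mulr_ge0// mulr_ge0 ?sqr_ge0.
have q0 : 0 <= expR (- L) * s by rewrite mulr_ge0 ?expR_ge0.
have q1 : 0 <= expR (- L) <= 1.
  by rewrite expR_ge0 -[leRHS]expR0 ler_expR oppr_le0 ltW.
have eX0 : 0 <= ep * (theta ^+ 2 / L * (v i ^+ 2 * v j ^+ 2)).
  by rewrite mulr_ge0// ltW.
have K0 : 0 < K := lt_le_trans k0 kK.
(* The hypothesis on [theta] is calibrated so that a flat coordinate times a non-peaked one stays in
   the small regime. *)
have small : r * v i * (r * v j) <= kappa * K -> s <= L / 2.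
  move=> h; have r20 : 0 < r ^+ 2 by rewrite exprn_gt0.
  rewrite -(ler_pM2l r20) /s.
  have := ler_wpM2l th0 h; lra.
have qE : expR (- L) * s = 2 * (expR (- L) * theta * (v i * v j)) by rewrite /s; ring.
have quad := bernoulli_mgf_quad ep0 epL L32 s0.
have triv := bernoulli_mgf_le q1 s0.
have tiny h := bernoulli_mgf_small ep0 epL s0 (small h).
rewrite /pair_cost /middle /=.
have rv0 k : 0 <= r * v k by rewrite mulr_ge0// ltW.
have excl k : flat r kappa v k -> peak r K v k = false.
  rewrite /flat /peak => h; apply/negbTE; rewrite -leNgt.
  exact: le_trans kK.
have lefl k : flat r kappa v k -> r * v k <= kappa by [].
have lepk k : ~~ peak r K v k -> r * v k <= K by rewrite /peak -leNgt.
have lemx k : flat r kappa v k -> r * v k <= K.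
  by move=> /lefl h; apply: le_trans kK.
case Fi: (flat r kappa v i); case Fj: (flat r kappa v j);
  rewrite ?(excl i Fi) ?(excl j Fj) /=.
- apply: le_trans (tiny _) _; first by apply: ler_pM (rv0 _) (rv0 _) _ _; [exact: lefl|exact: lemx].
  by rewrite ler_expR qE sE; lra.
- case Pj: (peak r K v j) => /=.
    by apply: le_trans quad _; rewrite ler_expR qE sE; lra.
  apply: le_trans (tiny _) _.
    by apply: ler_pM (rv0 _) (rv0 _) _ _; [exact: lefl|apply: lepk; rewrite Pj].
  by rewrite ler_expR qE sE; lra.
- case Pi: (peak r K v i) => /=.
    by apply: le_trans quad _; rewrite ler_expR qE sE; lra.
  apply: le_trans (tiny _) _.
    rewrite mulrC; apply: ler_pM (rv0 _) (rv0 _) _ _; [exact: lefl|by apply: lepk; rewrite Pi].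
  by rewrite ler_expR qE sE; lra.
- case Pi: (peak r K v i); case Pj: (peak r K v j) => /=.
  + apply: le_trans triv _; rewrite ler_expR.
    by move: q0; rewrite qE /s; lra.
  + by apply: le_trans quad _; rewrite ler_expR qE sE; lra.
  + by apply: le_trans quad _; rewrite ler_expR qE sE; lra.
  + by apply: le_trans quad _; rewrite ler_expR qE sE; lra.
Qed.

Lemma pair_cost_addC (R : realType) (n : nat) (L ep r kappa K theta : R)
    (v : 'I_n -> R) (i j : 'I_n) :
  pair_cost L ep r kappa K theta v i j + pair_cost L ep r kappa K theta v j i =
  2 * pair_cost L ep r kappa K theta v i j.
Proof. by rewrite /pair_cost /=; ring. Qed.

Lemma pair_cost_ge0 (R : realType) (n : nat) (L ep r kappa K theta : R)
    (v : 'I_n -> R) (i j : 'I_n) :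
  0 < L -> 0 < ep -> 0 <= theta -> (forall i, 0 <= v i) ->
  0 <= pair_cost L ep r kappa K theta v i j.
Proof.
move=> L0 ep0 th0 v0; have L0' := ltW L0; have ep0' := ltW ep0.
rewrite /pair_cost !(addr_ge0, mulr_ge0, sqr_ge0, expR_ge0, invr_ge0)//.
Qed.

(** Each term of the cost is a product of a function of [i] and a function of [j], so the double
    sums factor; the last one yields the quadratic form of [variational_bound]. *)
Lemma sum_pair_cost (R : realType) (n : nat) (L ep r kappa K theta : R)
    (v : 'I_n -> R) :
  let s := \sum_i (flat r kappa v i)%:R * v i ^+ 2 in
  let m := \sum_i (middle r kappa K v i)%:R * v i ^+ 2 in
  let l := \sum_i (peak r K v i)%:R * v i ^+ 2 in
  \sum_i \sum_j pair_cost L ep r kappa K theta v i j =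
  expR (- L) * theta * (\sum_i v i) ^+ 2 +
  2 * ep * (theta ^+ 2 / L) * (\sum_i v i ^+ 2) ^+ 2 +
  theta * (\sum_i (peak r K v i)%:R * v i) ^+ 2 +
  (1 + ep) * (theta ^+ 2 / L) * (m ^+ 2 / 2 + l * m + l * s).
Proof.
move=> s m l.
have dbl (a : R) (f g : 'I_n -> R) :
    \sum_i \sum_j a * (f i * g j) = a * ((\sum_i f i) * (\sum_i g i)).
  rewrite mulr_suml mulr_sumr; apply: eq_bigr => i _.
  by rewrite !mulr_sumr.
rewrite /pair_cost /=.
under eq_bigr => i _ do rewrite 3!big_split /=.
rewrite 3!big_split /= !dbl -!expr2; congr (_ + _ + _ + _).
under eq_bigr => i _ do under eq_bigr => j _ do rewrite !mulrDr.
under eq_bigr => i _ do rewrite !big_split /=.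
rewrite !big_split /= !dbl -/s -/m -/l.
by move: (theta ^+ 2 / L) => T; field.
Qed.

(** Chernoff's bound gives the exponent [c] up to errors from four sources: the loss of 3 in the
    threshold, the flat Cauchy-Schwarz estimate ([eta] and the term with [eta^-1]), the peak-peak
    pairs ([16 Y^2 kappa^2]) and the Bernoulli bounds ([ep]). *)
Lemma halfspace_prob (R : realType) (n : nat) (delta c L ep kappa eta r : R)
    (v : 'I_n -> R) (Y := 2 * (1 + delta)) :
  0 < delta -> 0 < c -> c <= (1 + delta) ^+ 2 / 2 -> c <= delta * (1 + delta) ->
  0 < ep -> ep <= 1 -> 8 / ep <= L -> 32 <= L ->
  0 < r -> r ^+ 2 = n%:R * expR (- L) ->
  0 < kappa -> 4 * Y * kappa ^+ 2 <= 1 -> 0 < eta ->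
  (forall i, 0 <= v i) -> \sum_i v i ^+ 2 <= 1 ->
  Gnp_prob (expR (- L)) (fun G : graph n => (1 + delta) * r ^+ 2 - 3 <=
    \sum_(e in G) edge_sum (fun i j => v i * v j) e) <=
  expR (- (r ^+ 4 * L * (c - (Y * (3 / r ^+ 2 + eta +
    (1 + eta^-1) * (expR (- L) / kappa ^+ 2) + 16 * Y ^+ 2 * kappa ^+ 2) +
    4 * ep * Y ^+ 2)))).
Proof.
move=> d0 c0 c1 c2 ep0 ep1 epL L32 r0 rE k0 Yk eta0 v0 v1.
have Y0 : 0 < Y by rewrite /Y; lra.
have YE : Y = 2 * (1 + delta) by [].
clearbody Y.
have L0 : 0 < L by lra.
(* The largest [K] for which every [theta <= Y r^2 L] meets the condition of [edge_mgf_bound]; then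
   [kappa <= K] is the hypothesis [4 Y kappa^2 <= 1]. *)
set K := (4 * Y * kappa)^-1.
have Ykap0 : 0 < 4 * Y * kappa by rewrite !mulr_gt0.
have K0 : 0 < K by rewrite invr_gt0.
have kK : kappa <= K.
  by rewrite /K -[leRHS]mul1r ler_pdivlMr//; move: Yk; lra.
have q01 : 0 < expR (- L) < 1.
  by rewrite expR_gt0 -[ltRHS]expR0 ltr_expR oppr_lt0.
set s := \sum_i (flat r kappa v i)%:R * v i ^+ 2.
set m := \sum_i (middle r kappa K v i)%:R * v i ^+ 2.
set l := \sum_i (peak r K v i)%:R * v i ^+ 2.
have x0 i : 0 <= v i ^+ 2 by rewrite sqr_ge0.
have s0 : 0 <= s by apply: sumr_ge0 => i _; rewrite mulr_ge0.
have m0 : 0 <= m by apply: sumr_ge0 => i _; rewrite mulr_ge0.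
have l0 : 0 <= l by apply: sumr_ge0 => i _; rewrite mulr_ge0.
have sml : s + m + l <= 1.
  apply: le_trans v1; rewrite /s /m /l -!big_split /=; apply: ler_sum => i _.
  rewrite -!mulrDl -[leRHS]mul1r ler_wpM2r// /middle.
  have : flat r kappa v i -> peak r K v i = false.
    by rewrite /flat /peak => h; apply/negbTE; rewrite -leNgt (le_trans h).
  by case: (flat r kappa v i) => [->//|_]; case: (peak r K v i);
    rewrite /= ?addr0 ?add0r.
set N := 1 + delta - s; have N0 : delta <= N by rewrite /N; lra.
set D := m ^+ 2 / 2 + l * m + l * s.
have DN : 4 * c * D <= N ^+ 2 by apply: variational_bound => //; exact: ltW.
have D0 : 0 <= D by rewrite /D !addr_ge0// ?divr_ge0 ?sqr_ge0 ?mulr_ge0.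
have D1 : D <= 1 by rewrite /D; nra.
have Np : 0 < N by lra.
(* The exact maximizer [N / (2 D)] of [y N - y^2 D] is unbounded as [D] tends to 0. This choice
   stays below [Y] and still gives at least [2 c - c = c], since [4 c D <= N^2]. *)
set y := 2 * c / N; have y0 : 0 <= y by rewrite /y divr_ge0 ?ltW// mulr_gt0.
have yN : y * N = 2 * c by rewrite /y divfK// gt_eqF.
have yY : y <= Y.
  rewrite /y ler_pdivrMr//; apply: (@le_trans _ _ (Y * delta)).
    by rewrite YE; lra.
  by rewrite ler_pM2l.
have yD : y ^+ 2 * D <= c.
  have N20 : 0 < N ^+ 2 by rewrite exprn_gt0.
  rewrite -(ler_pM2r N20).
  have -> : y ^+ 2 * D * N ^+ 2 = (y * N) ^+ 2 * D by ring.
  by rewrite yN; nra.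
clearbody y; set theta := y * r ^+ 2 * L.
have r20 : 0 < r ^+ 2 by rewrite exprn_gt0.
have th0 : 0 <= theta := mulr_ge0 (mulr_ge0 y0 (ltW r20)) (ltW L0).
have kKE : kappa * K = (4 * Y)^-1.
  by rewrite /K; field; rewrite !gt_eqF.
have thK : theta * (kappa * K) <= r ^+ 2 * (L / 4).
  rewrite kKE /theta ler_pdivrMr ?mulr_gt0//.
  have : y * (r ^+ 2 * L) <= Y * (r ^+ 2 * L).
    by rewrite ler_wpM2r// mulr_ge0 ?ltW.
  lra.
apply: le_trans (Gnp_chernoff _ _ q01 th0) _.
apply: (@le_trans _ _ (expR (- (theta * ((1 + delta) * r ^+ 2 - 3))) *
    expR (\sum_i \sum_j pair_cost L ep r kappa K theta v i j))).
  apply: ler_wpM2l; first exact: expR_ge0.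
  apply: (@le_trans _ _ (expR (\sum_(e : edge n)
    edge_sum (pair_cost L ep r kappa K theta v) e))).
    rewrite expR_sum; apply: ler_prod => e _; apply/andP; split.
      have := expR_ge0 (theta * edge_sum (fun i j => v i * v j) e).
      by move: q01 => /andP[]; nra.
    have [i [j [ij eij]]] := edgeP e; rewrite !(edge_sumE _ ij eij).
    have -> : v i * v j + v j * v i = 2 * (v i * v j) by ring.
    rewrite pair_cost_addC.
    exact: edge_mgf_bound.
  (* The diagonal costs, which belong to no edge, are nonnegative; adding them lets the double sum
     factor. *)
  rewrite ler_expR sum_edge_sum; apply: ler_sum => i _.
  rewrite [leRHS](bigID (fun j => i != j)) /= lerDl; apply: sumr_ge0 => j _.
  exact: pair_cost_ge0.
rewrite -expRD ler_expR sum_pair_cost -/s -/m -/l -/D.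
have hV := sum_sqr_flat r0 k0 eta0 v0 v1; rewrite -/s in hV.
have hP := sum_peak r0 K0 v0 v1.
have hX : (\sum_i v i ^+ 2) ^+ 2 <= 1.
  by rewrite expr_le1// sumr_ge0.
have T0 : 0 <= theta ^+ 2 / L by rewrite divr_ge0 ?sqr_ge0 ?ltW.
have qn : expR (- L) * n%:R = r ^+ 2 by rewrite mulrC.
have t1 : expR (- L) * theta * (\sum_i v i) ^+ 2 <=
  theta * r ^+ 2 * (s + eta + (1 + eta^-1) * (expR (- L) / kappa ^+ 2)).
  apply: le_trans (ler_wpM2l _ hV) _; first by rewrite mulr_ge0 ?expR_ge0.
  have -> : expR (- L) * theta * ((1 + eta) * n%:R * s +
      (1 + eta^-1) * (r / kappa) ^+ 2) =
    theta * (expR (- L) * n%:R) * ((1 + eta) * s) +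
    theta * r ^+ 2 * ((1 + eta^-1) * (expR (- L) / kappa ^+ 2)).
    by field; rewrite !gt_eqF.
  rewrite qn -mulrDr; apply: ler_wpM2l; first exact: mulr_ge0 th0 (ltW r20).
  rewrite lerD2r.
  have : eta * s <= eta by rewrite ger_pMr//; lra.
  lra.
have t2 : 2 * ep * (theta ^+ 2 / L) * (\sum_i v i ^+ 2) ^+ 2 <=
  2 * ep * (theta ^+ 2 / L).
  by rewrite ler_piMr// (mulr_ge0 (mulr_ge0 (ler0n _ 2) (ltW ep0)) T0).
have t3 : theta * (\sum_i (peak r K v i)%:R * v i) ^+ 2 <=
  theta * r ^+ 2 * (16 * Y ^+ 2 * kappa ^+ 2).
  rewrite -mulrA ler_wpM2l//; apply: le_trans hP _.
  by rewrite /K invrK; lra.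
have t4 : (1 + ep) * (theta ^+ 2 / L) * D <=
  theta ^+ 2 / L * D + ep * (theta ^+ 2 / L).
  have : ep * (theta ^+ 2 / L) * D <= ep * (theta ^+ 2 / L).
    by rewrite ler_piMr// (mulr_ge0 (ltW ep0) T0).
  lra.
set a := (1 + eta^-1) * (expR (- L) / kappa ^+ 2) in t1 *.
have a0 : 0 <= a.
  by rewrite /a mulr_ge0 ?addr_ge0 ?invr_ge0 ?divr_ge0 ?sqr_ge0 ?expR_ge0 ?(ltW eta0).
set b := 16 * Y ^+ 2 * kappa ^+ 2 in t3 *.
have b0 : 0 <= b.
  exact: mulr_ge0 (mulr_ge0 (ler0n _ 16) (sqr_ge0 _)) (sqr_ge0 _).
apply: le_trans (lerD (lexx _) (lerD (lerD (lerD t1 t2) t3) t4)) _.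
have TE : theta ^+ 2 / L = r ^+ 4 * L * y ^+ 2.
  by rewrite /theta; field; rewrite gt_eqF.
have thE : theta * r ^+ 2 = r ^+ 4 * L * y by rewrite /theta; ring.
have th3 : theta * 3 = r ^+ 4 * L * (y * (3 / r ^+ 2)).
  by rewrite /theta; field; rewrite gt_eqF.
rewrite TE thE.
have -> : - (theta * ((1 + delta) * r ^+ 2 - 3)) =
  - (theta * r ^+ 2 * (1 + delta)) + theta * 3 by ring.
rewrite th3 thE; set u := 3 / r ^+ 2.
have u0 : 0 <= u := divr_ge0 (ler0n _ 3) (ltW r20).
have W0 : 0 <= r ^+ 4 * L := mulr_ge0 (exprn_ge0 4 (ltW r0)) (ltW L0).
set W := r ^+ 4 * L in W0 *.
rewrite -[leRHS]mulrN.
rewrite [leLHS](_ : _ =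
  W * (- (y * N) + y ^+ 2 * D + y * (u + eta + a + b) + 3 * ep * y ^+ 2)); last first.
  by rewrite /N; ring.
apply: ler_wpM2l => //; rewrite yN.
have h1 : y * (u + eta + a + b) <= Y * (u + eta + a + b).
  by rewrite ler_wpM2r// !addr_ge0// ltW.
have h2 : 3 * ep * y ^+ 2 <= 4 * ep * Y ^+ 2.
  apply: ler_pM; rewrite ?mulr_ge0 ?sqr_ge0 ?(ltW ep0)//.
    by rewrite ler_wpM2r ?(ltW ep0)//; lra.
  by rewrite ler_sqr ?nnegrE// ltW.
lra.
Qed.

(** * Discretization of the sphere *)

(** The entries of the matrix are nonnegative, so replacing coordinates by their absolute values
    does not decrease the form. *)
Lemma unit_vector_of_lambda1 (R : realType) (n : nat) (G : graph n) (t : R) :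
  0 < t -> t <= lambda1 (adjacency R G) ->
  exists2 w : 'I_n -> R, (forall i, 0 <= w i) /\ \sum_i w i ^+ 2 = 1 &
  t - 1 <= \sum_i \sum_j w i * adjacency R G i j * w j.
Proof.
move=> t0 /(rayleigh_of_lambda1 t0)[v v0]; rewrite quad_form_sum => tv.
have N0 := dot_gt0 v0; set N := dot v v in N0 tv.
have sN0 : 0 < Num.sqrt N by rewrite sqrtr_gt0.
have sNN : Num.sqrt N ^+ 2 = N by rewrite sqr_sqrtr// ltW.
exists (fun i => `|v 0 i| / Num.sqrt N).
  split => [i|]; first by rewrite divr_ge0// ltW.
  under eq_bigr do rewrite exprMn exprVn sNN real_normK ?num_real//.
  rewrite -mulr_suml (_ : \sum_i v 0 i ^+ 2 = N) ?divff ?gt_eqF//.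
  by rewrite /N dot_sum; apply: eq_bigr => i _; rewrite expr2.
rewrite -(ler_pM2r N0) (le_trans tv)// mulr_suml; apply: ler_sum => i _.
rewrite mulr_suml; apply: ler_sum => j _.
have -> : `|v 0 i| / Num.sqrt N * adjacency R G i j * (`|v 0 j| / Num.sqrt N) * N =
    `|v 0 i| * adjacency R G i j * `|v 0 j|.
  by rewrite -[X in _ * X = _]sNN; field; rewrite gt_eqF.
have /andP[a0 _] := adjacency_ge0 R G i j.
by rewrite -{2}(ger0_norm a0) -!normrM ler_norm.
Qed.

(** The mesh [n^(-2)] is fine enough for a bounded rounding error and leaves only [(n^2 + 1)^n]
    points. *)
Definition grid (R : realType) (n : nat) (m : {ffun 'I_n -> 'I_(n ^ 2).+1})
  (i : 'I_n) : R := (m i)%:R / n%:R ^+ 2.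

(** Rounding down keeps the norm at most 1 and lowers each product of coordinates by at most
    [2 / n^2], hence the form by at most 2; the remaining unit was lost in
    [unit_vector_of_lambda1]. *)
Lemma grid_vector_of_lambda1 (R : realType) (n : nat) (G : graph n) (t : R) :
  (0 < n)%N -> 0 < t -> t <= lambda1 (adjacency R G) ->
  exists m : {ffun 'I_n -> 'I_(n ^ 2).+1}, \sum_i grid R m i ^+ 2 <= 1 /\
  t - 3 <= \sum_(e in G) edge_sum (fun i j => grid R m i * grid R m j) e.
Proof.
move=> n0 t0 /(unit_vector_of_lambda1 t0)[w [w0 w1] tw].
have N0 : 0 < n%:R ^+ 2 :> R by rewrite exprn_gt0// ltr0n.
have w_le1 i : w i <= 1.
  rewrite -(@ler_sqr _ (w i))// ?nnegrE// expr1n -w1 (bigD1 i)//= lerDl.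
  by apply: sumr_ge0 => j _; rewrite sqr_ge0.
have wN i : 0 <= w i * n%:R ^+ 2 by rewrite mulr_ge0// ltW.
have mP i : (Num.truncn (w i * n%:R ^+ 2) < (n ^ 2).+1)%N.
  rewrite ltnS -(ler_nat R) natrX (le_trans (y := w i * n%:R ^+ 2))//.
    by have /andP[] := truncn_itv (wN i).
  by rewrite ger_pMl.
exists [ffun i => Ordinal (mP i)]; set x := grid R _.
have xE i : x i = (Num.truncn (w i * n%:R ^+ 2))%:R / n%:R ^+ 2.
  by rewrite /x /grid ffunE.
have x0 i : 0 <= x i by rewrite xE divr_ge0// ltW.
have xw i : x i <= w i.
  by rewrite xE ler_pdivrMr//; have /andP[] := truncn_itv (wN i).
have wx i : w i <= x i + (n%:R ^+ 2)^-1.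
  rewrite xE -[X in _ + X]mul1r -mulrDl ler_pdivlMr// natr1 ltW//.
  by have /andP[] := truncn_itv (wN i).
split.
  by rewrite -w1; apply: ler_sum => i _; rewrite ler_sqr ?nnegrE.
rewrite -adjacency_quad_form.
suff : \sum_i \sum_j w i * adjacency R G i j * w j <=
    \sum_i \sum_j x i * adjacency R G i j * x j + 2 by lra.
have -> : (2 : R) = \sum_(i < n) \sum_(j < n) 2 / n%:R ^+ 2.
  rewrite !sumr_const !card_ord -mulrnA -[RHS]mulr_natr natrM -expr2 divfK//.
  by rewrite gt_eqF.
rewrite -big_split /=; apply: ler_sum => i _.
rewrite -big_split /=; apply: ler_sum => j _.
have /andP[a0 a1] := adjacency_ge0 R G i j.
set a := adjacency R G i j in a0 a1 *.
have h0 : 0 <= (n%:R ^+ 2)^-1 :> R by rewrite invr_ge0 ltW.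
have hi := wx i; have hj := wx j; set h := (n%:R ^+ 2)^-1 in h0 hi hj *.
have xi := xw i; have xj := xw j; have x0i := x0 i; have x0j := x0 j.
have wi := w_le1 i; have wj := w_le1 j.
have ww : w i * w j <= x i * x j + 2 * h by nra.
have := ler_wpM2l a0 ww.
have : a * (2 * h) <= 2 * h by rewrite ler_piMl // mulr_ge0.
lra.
Qed.

(** Union bound over the grid, the logarithm of whose cardinality is [n ln (n^2 + 1)]. *)
Lemma lambda1_upper_tail_bound (R : realType) (n : nat)
    (delta c L ep kappa eta r : R) (Y := 2 * (1 + delta)) :
  (0 < n)%N ->
  0 < delta -> 0 < c -> c <= (1 + delta) ^+ 2 / 2 -> c <= delta * (1 + delta) ->
  0 < ep -> ep <= 1 -> 8 / ep <= L -> 32 <= L ->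
  0 < r -> r ^+ 2 = n%:R * expR (- L) ->
  0 < kappa -> 4 * Y * kappa ^+ 2 <= 1 -> 0 < eta ->
  Gnp_prob (expR (- L)) (fun G : graph n =>
    (1 + delta) * r ^+ 2 <= lambda1 (adjacency R G)) <=
  expR (n%:R * ln (n%:R ^+ 2 + 1) -
    r ^+ 4 * L * (c - (Y * (3 / r ^+ 2 + eta +
    (1 + eta^-1) * (expR (- L) / kappa ^+ 2) + 16 * Y ^+ 2 * kappa ^+ 2) +
    4 * ep * Y ^+ 2))).
Proof.
move=> n0 d0 c0 c1 c2 ep0 ep1 epL L32 r0 rE k0 Yk eta0.
have L0 : 0 < L by lra.
have q01 : 0 < expR (- L) < 1.
  by rewrite expR_gt0 -[ltRHS]expR0 ltr_expR oppr_lt0.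
have t0 : 0 < (1 + delta) * r ^+ 2.
  by rewrite mulr_gt0 ?exprn_gt0//; lra.
pose P (m : {ffun 'I_n -> 'I_(n ^ 2).+1}) := \sum_i grid R m i ^+ 2 <= 1.
pose E m (G : graph n) := (1 + delta) * r ^+ 2 - 3 <=
    \sum_(e in G) edge_sum (fun i j => grid R m i * grid R m j) e.
apply: (@le_trans _ _ (Gnp_prob (expR (- L))
    (fun G : graph n => [exists m, P m && E m G]))).
  apply: le_Gnp_prob => // G /(grid_vector_of_lambda1 n0 t0)[m [m1 mt]].
  by apply/existsP; exists m; rewrite /P m1.
apply: le_trans (Gnp_prob_union _ _ q01) _.
set B := r ^+ 4 * L * _.
apply: (@le_trans _ _ (\sum_(m | P m) expR (- B))).
  apply: ler_sum => m Pm; apply: halfspace_prob => //.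
  by move=> i; rewrite /grid divr_ge0// sqr_ge0.
apply: (@le_trans _ _
    (\sum_(m : {ffun 'I_n -> 'I_(n ^ 2).+1}) expR (- B))).
  by rewrite [leLHS]big_mkcond /=; apply: ler_sum => m _; case: ifP;
    rewrite ?expR_ge0.
rewrite sumr_const card_ffun !card_ord expRD -[leLHS]mulr_natl ler_wpM2r ?expR_ge0//.
rewrite natrX expRM_natl lnK ?posrE ?ltr_wpDl ?exprn_ge0//.
by rewrite -natr1 natrX.
Qed.

(** * Planted cliques and hubs *)

Lemma sum_offdiag (R : realType) (n : nat) (F : 'I_n -> 'I_n -> R) :
  \sum_i \sum_(j | i != j) F i j = \sum_i \sum_j F i j - \sum_i F i i.
Proof.
rewrite -sumrB; apply: eq_bigr => i _.
rewrite [X in _ = X - _](bigD1 i)//= addrAC subrr add0r.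
by apply: eq_bigl => j; rewrite eq_sym.
Qed.

Definition edges_in (n : nat) (C : {set 'I_n}) : {set edge n} :=
  [set e : edge n | val e \subset C]%SET.

Definition edges_between (n : nat) (C : {set 'I_n}) : {set edge n} :=
  [set e : edge n | ~~ (val e \subset C) && ~~ (val e \subset ~: C)%SET]%SET.

Lemma mem_edges_in (n : nat) (C : {set 'I_n}) (e : edge n) (i j : 'I_n) :
  val e = [set i; j]%SET -> (e \in edges_in C) = (i \in C) && (j \in C).
Proof. by move=> eE; rewrite inE eE finset.subUset !finset.sub1set. Qed.

Lemma mem_edges_between (n : nat) (C : {set 'I_n}) (e : edge n) (i j : 'I_n) :
  val e = [set i; j]%SET ->
  (e \in edges_between C) = (i \in C) (+) (j \in C).
Proof.
move=> eE; rewrite inE eE !finset.subUset !finset.sub1set !inE.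
by case: (i \in C); case: (j \in C).
Qed.

(** Double counting of ordered pairs; the diagonal ones are subtracted. *)
Lemma card_edges_in (R : realType) (n : nat) (C : {set 'I_n}) :
  2 * #|edges_in C|%:R = #|C|%:R ^+ 2 - #|C|%:R :> R.
Proof.
transitivity (\sum_(e : edge n)
    edge_sum (fun i j => (i \in C)%:R * (j \in C)%:R : R) e).
  rewrite -sumr_const mulr_sumr [LHS]big_mkcond /=; apply: eq_bigr => e _.
  have [i [j [ij eij]]] := edgeP e.
  rewrite (edge_sumE _ ij eij) (mem_edges_in _ eij).
  by case: (i \in C); case: (j \in C); rewrite /=; ring.
have cardE : \sum_(i : 'I_n) (i \in C)%:R = #|C|%:R :> R.
  by rewrite -sumr_const [RHS]big_mkcond /=; apply: eq_bigr => i _; case: ifP.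
rewrite sum_edge_sum sum_offdiag expr2 -{1 2}cardE mulr_suml; congr (_ - _).
  by apply: eq_bigr => i _; rewrite mulr_sumr.
by rewrite -cardE; apply: eq_bigr => i _; case: (i \in C); rewrite /=; ring.
Qed.

Lemma card_edges_between (R : realType) (n : nat) (C : {set 'I_n}) :
  #|edges_between C|%:R = #|C|%:R * #|~: C|%:R :> R.
Proof.
transitivity (\sum_(e : edge n)
    edge_sum (fun i j => (i \in C)%:R * (j \in ~: C)%:R : R) e).
  rewrite -sumr_const [LHS]big_mkcond /=; apply: eq_bigr => e _.
  have [i [j [ij eij]]] := edgeP e.
  rewrite (edge_sumE _ ij eij) (mem_edges_between _ eij) !inE.
  by case: (i \in C); case: (j \in C); rewrite /=; ring.
have cardE (D : {set 'I_n}) : \sum_(i : 'I_n) (i \in D)%:R = #|D|%:R :> R.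
  by rewrite -sumr_const [RHS]big_mkcond /=; apply: eq_bigr => i _; case: ifP.
rewrite sum_edge_sum sum_offdiag [X in _ - X]big1 ?subr0 => [|i _].
  rewrite -!cardE mulr_suml.
  by apply: eq_bigr => i _; rewrite mulr_sumr.
by rewrite inE; case: (i \in C); rewrite /= ?mulr0 ?mul0r.
Qed.

Lemma lambda1_ge_test (R : realType) (n : nat) (G : graph n) (x : 'I_n -> R)
    (t : R) :
  0 < \sum_i x i ^+ 2 ->
  t * \sum_i x i ^+ 2 <= \sum_(e in G) edge_sum (fun i j => x i * x j) e ->
  t <= lambda1 (adjacency R G).
Proof.
move=> x0; rewrite -adjacency_quad_form => tx.
pose v := \row_i x i.
have vE : dot v v = \sum_i x i ^+ 2.
  by rewrite dot_sum; apply: eq_bigr => i _; rewrite !mxE expr2.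
apply: (@rayleigh_le_lambda1 _ _ _ v); first exact: adjacency_sym.
  apply: contraTneq x0 => v0; rewrite -vE v0 /dot mul0mx mxE ltxx//.
rewrite vE quad_form_sum (le_trans tx)//; apply: ler_sum => i _.
by apply: ler_sum => j _; rewrite ![v _ _]mxE.
Qed.

Lemma exists_set_card (n k : nat) : (k <= n)%N ->
  exists C : {set 'I_n}, #|C| = k.
Proof.
move=> kn; exists [set widen_ord kn i | i : 'I_k]%SET.
rewrite card_imset ?card_ord// => i j /(congr1 val) /= ij; exact: val_inj.
Qed.

(** A planted clique on [k] vertices costs [p] per edge, and its indicator vector has Rayleigh
    quotient at least [k - 1]. *)
Lemma clique_prob (R : realType) (n k : nat) (L : R) :
  0 < L -> (0 < k <= n)%N ->
  expR (- (L * ((k%:R ^+ 2 - k%:R) / 2))) <=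
  Gnp_prob (expR (- L)) (fun G : graph n =>
    k%:R - 1 <= lambda1 (adjacency R G)).
Proof.
move=> L0 /andP[k0 kn].
have q01 : 0 < expR (- L) < 1.
  by rewrite expR_gt0 -[ltRHS]expR0 ltr_expR oppr_lt0.
have [C Ck] := exists_set_card kn.
apply: (@le_trans _ _ (Gnp_prob (expR (- L))
    (fun G : graph n => edges_in C \subset G))).
  have := card_edges_in R C; rewrite Ck => <-.
  by rewrite Gnp_prob_supset -expRM_natl ler_expR; lra.
apply: le_Gnp_prob => // G /fintype.subsetP CG.
pose x i : R := (i \in C)%:R.
have xE : \sum_i x i ^+ 2 = k%:R.
  rewrite -Ck -sumr_const [RHS]big_mkcond /=; apply: eq_bigr => i _.
  by rewrite /x; case: (i \in C); rewrite /= ?expr1n ?expr0n.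
apply: (@lambda1_ge_test _ _ _ x); rewrite xE ?ltr0n//.
have -> : (k%:R - 1) * k%:R = 2 * #|edges_in C|%:R :> R.
  by rewrite card_edges_in Ck; ring.
rewrite -sumr_const mulr_sumr big_mkcond [leRHS]big_mkcond /=.
apply: ler_sum => e _; have [i [j [ij eij]]] := edgeP e.
have /implyP := CG e; rewrite (edge_sumE _ ij eij) (mem_edges_in _ eij) /x.
by case: (i \in C); case: (j \in C); case: (e \in G) => //= _;
  rewrite ?mulr1 ?mulr0 ?mul0r ?addr0.
Qed.

(** All edges between a [k]-set and its complement are planted, and the complement keeps nearly its
    mean number of edges. The hypothesis on [t] is the Rayleigh inequality for the vector equal to
    [a] on the hub and 1 elsewhere. *)
Lemma hub_prob (R : realType) (n k : nat) (L ep a t : R) :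
  0 < L -> (0 < k < n)%N -> 0 < ep -> 0 <= a ->
  let u : R := n%:R - k%:R in
  t * (a ^+ 2 * k%:R + u) <=
    2 * a * (k%:R * u) + (1 - ep) * expR (- L) * (u ^+ 2 - u) ->
  expR (- (L * (k%:R * u))) *
    (1 - expR (- (ep ^+ 2 * expR (- L) * (u ^+ 2 - u) / 8))) <=
  Gnp_prob (expR (- L)) (fun G : graph n => t <= lambda1 (adjacency R G)).
Proof.
move=> L0 /andP[k0 kn] ep0 a0 u htest.
have q01 : 0 < expR (- L) < 1.
  by rewrite expR_gt0 -[ltRHS]expR0 ltr_expR oppr_lt0.
have [C Ck] := exists_set_card (ltnW kn).
have Cu : #|~: C|%:R = u by rewrite /u cardsCs finset.setCK card_ord Ck natrB 1?ltnW.
have bE : #|edges_between C|%:R = k%:R * u by rewrite card_edges_between Ck Cu.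
have wE : 2 * #|edges_in (~: C)|%:R = u ^+ 2 - u by rewrite card_edges_in Cu.
have dis e : e \in edges_between C -> e \notin edges_in (~: C).
  by rewrite !inE => /andP[].
apply: le_trans (le_trans (Gnp_lower_tail q01 ep0 dis) _).
  rewrite -expRM_natl bE -wE mulrN [_ * L]mulrC.
  set w := #|edges_in _|%:R.
  have -> : ep ^+ 2 * expR (- L) * (2 * w) / 8 = ep ^+ 2 * expR (- L) * w / 4.
    by field.
  exact: lexx.
apply: le_Gnp_prob => // G /andP[/fintype.subsetP HG WG].
pose x i : R := if i \in C then a else 1.
have xE : \sum_i x i ^+ 2 = a ^+ 2 * k%:R + u.
  rewrite -Ck -Cu -!sumr_const mulr_sumr [X in _ = X + _]big_mkcond.
  rewrite [X in _ = _ + X]big_mkcond -big_split /=; apply: eq_bigr => i _.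
  by rewrite /x inE; case: (i \in C); rewrite /= ?expr1n ?mulr1 ?addr0 ?add0r.
have u0 : 0 < u by rewrite subr_gt0 ltr_nat.
apply: (@lambda1_ge_test _ _ _ x); rewrite xE.
  by rewrite ltr_wpDl// mulr_ge0 ?sqr_ge0.
apply: le_trans htest _.
apply: (@le_trans _ _ (2 * a * #|edges_between C|%:R +
    2 * #|G :&: edges_in (~: C)|%:R)).
  rewrite bE lerD2l -wE; move: WG; lra.
rewrite -!sumr_const !mulr_sumr [X in X + _]big_mkcond [X in _ + X]big_mkcond.
rewrite -big_split /= [leRHS]big_mkcond /=; apply: ler_sum => e _.
have [i [j [ij eij]]] := edgeP e; have /implyP := HG e.
rewrite finset.in_setI (edge_sumE _ ij eij) (mem_edges_between _ eij).
rewrite (mem_edges_in _ eij) /x !finset.in_setC.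
have a20 : 0 <= a * a by rewrite mulr_ge0.
by case: (i \in C); case: (j \in C); case: (e \in G) => //= _; lra.
Qed.

(** * Asymptotics *)

(** With [x = n^(1/2) p] and [p = exp (- L)], [N] is [n]. The grid entropy is thus expressed in [x]
    and [L], to be compared with [n^2 p^2 L = n x^2 L]. *)
Lemma ln_sqr_succ_le (R : realType) (N x L : R) :
  0 < x -> 0 < L -> N = x ^+ 2 * expR (2 * L) ->
  ln (N ^+ 2 + 1) <= 1 + 4 * x + 4 * L.
Proof.
move=> x0 L0 NE.
have ex : x <= expR x by apply: le_trans (expR_ge1Dx x); rewrite lerDr.
have N0 : 0 <= N by rewrite NE mulr_ge0 ?sqr_ge0 ?expR_ge0.
have NM : N <= expR (2 * x + 2 * L).
  rewrite NE expRD ler_wpM2r ?expR_ge0//.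
  by rewrite expRM_natl ler_sqr ?nnegrE ?expR_ge0 ?(ltW x0).
have N2 : N ^+ 2 <= expR (4 * x + 4 * L).
  have -> : 4 * x + 4 * L = 2%:R * (2 * x + 2 * L) by ring.
  by rewrite expRM_natl ler_sqr ?nnegrE ?expR_ge0.
have E1 : 1 <= expR (4 * x + 4 * L) by rewrite -[leLHS]expR0 ler_expR; lra.
have e2 : 2 <= expR 1 :> R by have := expR_ge1Dx (1 : R); lra.
rewrite -[leRHS]expRK ler_ln ?posrE ?expR_gt0//; last first.
  by rewrite ltr_wpDl// sqr_ge0.
rewrite -addrA expRD; nra.
Qed.

(** The parameters make each of the five error terms at most [e / 8]; the grid entropy, relative to
    [n^2 q^2 L], takes one more [e / 8]. *)
Lemma lambda1_upper_tail_le (R : realType) (n : nat) (delta c e L q x : R) :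
  let Y := 2 * (1 + delta) in
  let eta := e / (8 * Y) in
  let kappa := Num.min 1 (Num.min (4 * Y)^-1 (e / (128 * Y ^+ 3))) in
  let ep := Num.min 1 (e / (32 * Y ^+ 2)) in
  0 < delta -> 0 < c -> c <= (1 + delta) ^+ 2 / 2 -> c <= delta * (1 + delta) ->
  0 < e -> q = expR (- L) -> x = Num.sqrt n%:R * q ->
  8 / ep <= L -> 32 <= L ->
  q <= e / 8 / (Y * (1 + eta^-1) / kappa ^+ 2) ->
  1 <= x -> 24 * Y / e <= x -> 72 / e <= x ->
  Gnp_prob q (fun G : graph n =>
    (1 + delta) * n%:R * q <= lambda1 (adjacency R G)) <=
  expR (- (n%:R ^+ 2 * q ^+ 2 * L * (c - e))).
Proof.
move=> Y eta kappa ep d0 c0 c1 c2 e0 qE xE epL L32 qs x1 xY xe.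
have Y0 : 0 < Y by rewrite /Y; lra.
have eta0 : 0 < eta by rewrite /eta divr_gt0// mulr_gt0.
have kap0 : 0 < kappa.
  rewrite /kappa !lt_min ltr01 invr_gt0 mulr_gt0//= divr_gt0// mulr_gt0//.
  exact: exprn_gt0.
have kap1 : kappa <= 1 by rewrite /kappa ge_min lexx.
have kap2 : kappa <= (4 * Y)^-1 by rewrite /kappa !ge_min lexx orbT.
have kap3 : kappa <= e / (128 * Y ^+ 3) by rewrite /kappa !ge_min lexx !orbT.
have ep0 : 0 < ep.
  by rewrite /ep lt_min ltr01 divr_gt0// mulr_gt0// exprn_gt0.
have ep1 : ep <= 1 by rewrite /ep ge_min lexx.
have ep2 : ep <= e / (32 * Y ^+ 2) by rewrite /ep !ge_min lexx orbT.
have h2 : Y * eta = e / 8 by rewrite /eta; field; rewrite gt_eqF.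
clearbody eta kappa ep.
(* The cap of [kappa] at 1 lets linear thresholds control [kappa ^+ 2], without square roots. *)
have kapsq : kappa ^+ 2 <= kappa by rewrite expr2 ger_pMr.
have Ykap : 4 * Y * kappa ^+ 2 <= 1.
  have Y4 : 0 < 4 * Y by rewrite mulr_gt0.
  apply: le_trans (ler_wpM2l (ltW Y4) (le_trans kapsq kap2)) _.
  by rewrite mulfV ?gt_eqF.
have q0 : 0 < q by rewrite qE expR_gt0.
have L0 : 0 < L by lra.
have q1 : q < 1 by rewrite qE -[ltRHS]expR0 ltr_expR oppr_lt0.
have sn0 : 0 < Num.sqrt n%:R :> R.
  by rewrite -(pmulr_lgt0 _ q0) -xE; lra.
have n0 : (0 < n)%N by move: sn0; rewrite sqrtr_gt0 ltr0n.
have snE : Num.sqrt n%:R ^+ 2 = n%:R :> R by rewrite sqr_sqrtr.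
have nR0 : 0 < n%:R :> R by rewrite ltr0n.
set r := Num.sqrt (n%:R * q).
have nq0 : 0 < n%:R * q by rewrite mulr_gt0.
have r0 : 0 < r by rewrite sqrtr_gt0.
have rE : r ^+ 2 = n%:R * q by rewrite sqr_sqrtr// ltW.
have r4 : r ^+ 4 = n%:R ^+ 2 * q ^+ 2.
  by rewrite (exprM r 2 2) rE exprMn.
have xsn : x <= Num.sqrt n%:R by rewrite xE ger_pMr// ltW.
have rx : x <= r ^+ 2.
  have -> : r ^+ 2 = Num.sqrt n%:R * x by rewrite rE xE mulrA -expr2 snE.
  by rewrite ler_peMl//; lra.
clearbody r.
rewrite -r4 -mulrA -rE {1}qE.
rewrite {1}qE in rE.
apply: le_trans (lambda1_upper_tail_bound n0 d0 c0 c1 c2 ep0 ep1 epL L32 r0 rE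
  kap0 Ykap eta0) _.
rewrite -qE -/Y ler_expR.
have h1 : Y * (3 / r ^+ 2) <= e / 8.
  have r20 : 0 < r ^+ 2 by rewrite exprn_gt0.
  rewrite mulrA ler_pdivrMr//.
  have : 24 * Y / e <= r ^+ 2 by apply: le_trans rx.
  rewrite ler_pdivrMr//; lra.
have h3 : Y * ((1 + eta^-1) * (q / kappa ^+ 2)) <= e / 8.
  have eta1 : 0 < 1 + eta^-1 by rewrite addr_gt0// invr_gt0.
  have Z0 : 0 < Y * (1 + eta^-1) / kappa ^+ 2.
    by rewrite divr_gt0 ?exprn_gt0// mulr_gt0.
  move: qs; rewrite ler_pdivlMr// => qs; apply: le_trans qs.
  by rewrite le_eqVlt; apply/orP; left; apply/eqP; field; rewrite !gt_eqF.
have h4 : Y * (16 * Y ^+ 2 * kappa ^+ 2) <= e / 8.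
  have : kappa ^+ 2 <= e / (128 * Y ^+ 3) by exact: le_trans kap3.
  rewrite ler_pdivlMr ?mulr_gt0 ?exprn_gt0//; lra.
have h5 : 4 * ep * Y ^+ 2 <= e / 8.
  by move: ep2; rewrite ler_pdivlMr ?mulr_gt0 ?exprn_gt0//; lra.
have h6 : n%:R * ln (n%:R ^+ 2 + 1) <= r ^+ 4 * L * (e / 8).
  have NE : n%:R = x ^+ 2 * expR (2 * L).
    rewrite xE exprMn snE qE -expRM_natl -mulrA -expRD mulrN addNr expR0.
    by rewrite mulr1.
  have x0 : 0 < x by lra.
  have r4E : r ^+ 4 = n%:R * x ^+ 2 by rewrite r4 xE exprMn snE; ring.
  rewrite r4E -!mulrA ler_wpM2l ?(ltW nR0)//.
  apply: le_trans (ln_sqr_succ_le x0 L0 NE) _.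
  apply: (@le_trans _ _ (9 * (x * L))).
    have : 1 <= x * L by nra.
    have : x <= x * L by rewrite ler_peMr//; lra.
    have : L <= x * L by rewrite ler_peMl//; lra.
    lra.
  (* The constant is [9 * 8]: it turns [9 x L] into at most [x^2 L e / 8]. *)
  have xe72 : 72 <= x * e by rewrite -ler_pdivrMr.
  have xL0 : 0 <= x * L by rewrite mulr_ge0// ltW.
  have := ler_wpM2l xL0 xe72; lra.
have W0 : 0 <= r ^+ 4 * L := mulr_ge0 (exprn_ge0 4 (ltW r0)) (ltW L0).
set W := r ^+ 4 * L in W0 h6 *; set E := (X in c - X).
have hE : E <= e * (5 / 8).
  by rewrite /E !mulrDr; lra.
have : W * E <= W * (e * (5 / 8)) by rewrite ler_wpM2l.
have : 0 <= W * e by rewrite mulr_ge0// ltW.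
lra.
Qed.

Lemma sqrt_scale (R : realType) (n : nat) (q x : R) :
  0 < q -> q < 1 -> x = Num.sqrt n%:R * q -> 1 <= x ->
  [/\ (0 < n)%N, x ^+ 2 = n%:R * q ^+ 2, x <= n%:R * q & x <= n%:R].
Proof.
move=> q0 q1 xE x1.
have snE : Num.sqrt n%:R ^+ 2 = n%:R :> R by rewrite sqr_sqrtr.
have sn0 : 0 < Num.sqrt n%:R :> R by rewrite -(pmulr_lgt0 _ q0) -xE; lra.
have xsn : x <= Num.sqrt n%:R by rewrite xE ger_pMr// ltW.
split; first by move: sn0; rewrite sqrtr_gt0 ltr0n.
- by rewrite xE exprMn snE.
- have -> : n%:R * q = Num.sqrt n%:R * x by rewrite xE mulrA -expr2 snE.
  by rewrite ler_peMl//; lra.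
- by rewrite -snE expr2 (le_trans xsn)// ler_peMl// (le_trans x1).
Qed.

Lemma lambda1_upper_tail_ge_clique (R : realType) (n : nat)
    (delta e L q x : R) :
  0 < delta -> 0 < e -> 0 < L -> q = expR (- L) -> x = Num.sqrt n%:R * q ->
  q * (2 * (1 + delta)) <= 1 -> 4 <= x -> (2 * (1 + delta) + 2) / e <= x ->
  expR (- (n%:R ^+ 2 * q ^+ 2 * L * ((1 + delta) ^+ 2 / 2 + e))) <=
  Gnp_prob q (fun G : graph n =>
    (1 + delta) * n%:R * q <= lambda1 (adjacency R G)).
Proof.
move=> d0 e0 L0 qE xE qs x4 xe.
have q0 : 0 < q by rewrite qE expR_gt0.
have q1 : q < 1 by rewrite qE -[ltRHS]expR0 ltr_expR oppr_lt0.
have x1 : 1 <= x by lra.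
have [n0 x2 xr xn] := sqrt_scale q0 q1 xE x1.
set r := n%:R * q in xr.
(* One unit makes up for the truncation, the other for the [- 1] in the eigenvalue of a clique. *)
set k := (Num.truncn ((1 + delta) * r)).+2.
have r0 : 0 < r by rewrite mulr_gt0// ltr0n.
have dr0 : 0 <= (1 + delta) * r by rewrite mulr_ge0 ?(ltW r0)//; lra.
have /andP[kl kr] := truncn_itv dr0.
have k2 : k%:R = (Num.truncn ((1 + delta) * r))%:R + 2 :> R.
  by rewrite /k -addn2 natrD.
have kn : (0 < k <= n)%N.
  rewrite /= -(ler_nat R) k2.
  have : n%:R * (q * (2 * (1 + delta))) <= n%:R * 1 by rewrite ler_wpM2l.
  rewrite /r in kl; lra.
apply: le_trans (le_trans (clique_prob L0 kn) _); last first.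
  rewrite -qE; apply: le_Gnp_prob; first by rewrite q0.
  move=> G; apply: le_trans; rewrite k2 -mulrA -/r.
  by move: kr; rewrite -natr1; lra.
have -> : n%:R ^+ 2 * q ^+ 2 = r ^+ 2 by rewrite exprMn.
rewrite ler_expR lerN2 [r ^+ 2 * L]mulrC -mulrA; apply: ler_wpM2l; first exact: ltW.
have k0 : 0 <= k%:R :> R by [].
have kr2 : k%:R <= (1 + delta) * r + 2 by rewrite k2; lra.
apply: (@le_trans _ _ (((1 + delta) * r + 2) ^+ 2 / 2)).
  have : k%:R ^+ 2 <= ((1 + delta) * r + 2) ^+ 2 by rewrite ler_sqr ?nnegrE//; lra.
  lra.
have hr : 2 * (1 + delta) + 2 <= r * e.
  by rewrite -ler_pdivrMr//; apply: le_trans xr.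
have r1 : 1 <= r by lra.
have := ler_wpM2l (ltW r0) hr.
have -> : ((1 + delta) * r + 2) ^+ 2 / 2 =
  r ^+ 2 * ((1 + delta) ^+ 2 / 2) + r * (2 * (1 + delta)) + 2 by field.
rewrite mulrDr; lra.
Qed.

(** Half of [e] enlarges the hub to about [h n q^2] vertices, to offset the loss of [ep] in the edge
    count and of a proportion [sigma] of the vertices; the other half pays for the rounding of [k]
    and the constant probability. *)
Lemma lambda1_upper_tail_ge_hub (R : realType) (n : nat) (delta e L q x : R) :
  let ep := e / (8 * (1 + delta)) in
  let sigma := ep / (1 + delta + 4 * ep) in
  let h := delta * (1 + delta) + e / 2 in
  0 < delta -> 0 < e -> e <= 1 -> 1 <= L ->
  q = expR (- L) -> x = Num.sqrt n%:R * q ->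
  q * (2 * h) <= sigma -> 2 / sigma <= x ->
  4 / e <= x -> 16 / ep ^+ 2 <= x ->
  expR (- (n%:R ^+ 2 * q ^+ 2 * L * (delta * (1 + delta) + e))) <=
  Gnp_prob q (fun G : graph n =>
    (1 + delta) * n%:R * q <= lambda1 (adjacency R G)).
Proof.
move=> ep sigma h d0 e0 e1 L1 qE xE qs xs xe xep.
have l0 : 0 < 1 + delta by lra.
have L0 : 0 < L by lra.
have q0 : 0 < q by rewrite qE expR_gt0.
have q1 : q < 1 by rewrite qE -[ltRHS]expR0 ltr_expR oppr_lt0.
have ep0 : 0 < ep by rewrite /ep divr_gt0// mulr_gt0.
have epE : e = 8 * (1 + delta) * ep by rewrite /ep; field; rewrite gt_eqF.
have ep8 : ep <= 1 / 8 by nra.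
have hE0 : h = delta * (1 + delta) + e / 2 by [].
have hE : h = (1 + delta) * (delta + 4 * ep) by rewrite /h epE; field.
have h0 : 0 < h by rewrite hE mulr_gt0//; lra.
have D0 : 0 < 1 + delta + 4 * ep by lra.
have s0 : 0 < sigma by rewrite /sigma divr_gt0.
have sE : sigma * (1 + delta + 4 * ep) = ep by rewrite /sigma divfK// gt_eqF.
clearbody h sigma ep.
have s8 : sigma <= 1 / 8 by nra.
have x1 : 1 <= x.
  by move: xe; rewrite ler_pdivrMr//; nra.
have [n0 x2 xr xn] := sqrt_scale q0 q1 xE x1.
have nR0 : 0 < n%:R :> R by rewrite ltr0n.
have xX : x <= x ^+ 2 by rewrite expr2 ler_peMl//; lra.
set X := x ^+ 2 in x2 xX.
have hX0 : 0 <= h * X by rewrite mulr_ge0 ?sqr_ge0 ?(ltW h0).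
set k := (Num.truncn (h * X)).+1.
have /andP[kl kr] := truncn_itv hX0.
have k1 : k%:R = (Num.truncn (h * X))%:R + 1 :> R by rewrite /k natr1.
rewrite -/k in kr.
have sn : 2 <= sigma * n%:R.
  have : 2 <= x * sigma by rewrite -ler_pdivrMr.
  by have := ler_wpM2r (ltW s0) xn; lra.
have ks : k%:R <= sigma * n%:R.
  have : h * X <= sigma * n%:R / 2.
    have := ler_wpM2l (ltW nR0) (ler_wpM2r (ltW q0) qs).
    have : n%:R * (sigma * q) <= n%:R * sigma.
      by rewrite ler_wpM2l ?(ltW nR0)// ger_pMr// ltW.
    by rewrite x2; lra.
  by rewrite k1; lra.
have kn : (0 < k < n)%N.
  by rewrite /= -(ltr_nat R) (le_lt_trans ks)//; nra.
set u : R := n%:R - k%:R.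
have un : (1 - sigma) * n%:R <= u by rewrite /u; lra.
have ule : u <= n%:R by rewrite /u gerBl.
have uu : (1 - 3 * sigma) * n%:R ^+ 2 <= u ^+ 2 - u.
  have um : (1 - 2 * sigma) * n%:R <= u - 1 by lra.
  have nn1 : 0 <= (1 - sigma) * n%:R by rewrite mulr_ge0//; lra.
  have nn2 : 0 <= (1 - 2 * sigma) * n%:R by rewrite mulr_ge0//; lra.
  have := ler_pM nn1 nn2 un um; have := sqr_ge0 (sigma * n%:R); lra.
(* The top eigenvector of the planted graph is about [((1 + delta) q)^-1] on the
   hub and [1] elsewhere. *)
have a0 : 0 <= ((1 + delta) * q)^-1 by rewrite invr_ge0 mulr_ge0 ?ltW.
apply: le_trans (le_trans (hub_prob L0 kn ep0 a0
  (t := (1 + delta) * n%:R * q) _) _); last 1 first.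
- by rewrite -qE.
- rewrite -/u -qE.
  have uu0 : 1 / 2 * n%:R ^+ 2 <= u ^+ 2 - u.
    by apply: le_trans uu; rewrite ler_wpM2r ?sqr_ge0//; lra.
  (* A constant lower bound suffices; in the form [exp (- 1)] it merely adds 1 to the exponent. *)
  have half : expR (- 1) <= 1 - expR (- (ep ^+ 2 * q * (u ^+ 2 - u) / 8)).
    have n2q : 16 / ep ^+ 2 <= q * n%:R ^+ 2.
      apply: le_trans xep _; apply: le_trans xr _.
      by rewrite mulrC expr2 ler_wpM2l ?(ltW q0)// ler_peMl// ler1n.
    have z1 : 1 <= ep ^+ 2 * q * (u ^+ 2 - u) / 8.
      move: n2q; rewrite ler_pdivrMr ?exprn_gt0// => n2q.
      have w0 : 0 <= ep ^+ 2 * q by rewrite mulr_ge0 ?sqr_ge0 ?(ltW q0).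
      have := ler_wpM2l w0 uu0; lra.
    have : expR (- (ep ^+ 2 * q * (u ^+ 2 - u) / 8)) <= (expR 1)^-1.
      by rewrite -expRN ler_expR lerN2.
    have e2 : 2 <= expR 1 :> R by have := expR_ge1Dx (1 : R); lra.
    have : (expR 1)^-1 <= 2^-1 :> R by rewrite lef_pV2 ?posrE ?expR_gt0.
    by rewrite [expR (- 1)]expRN; lra.
  apply: (@le_trans _ _ (expR (- (L * (k%:R * u))) * expR (- 1))); last first.
    by rewrite ler_wpM2l ?expR_ge0.
  rewrite -expRD ler_expR -opprD lerN2.
  have ku : k%:R * u <= (h * X + 1) * n%:R.
    by apply: ler_pM => //; [rewrite (le_trans _ un)// mulr_ge0//; lra|rewrite k1 lerD2r].
  have -> : n%:R ^+ 2 * q ^+ 2 = n%:R * X by rewrite x2; ring.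
  have -> : delta * (1 + delta) + e = h + e / 2 by rewrite hE0; field.
  have Xe : 4 <= X * e by rewrite -ler_pdivrMr// (le_trans xe).
  have nL : 1 <= n%:R * L.
    by rewrite (le_trans L1)// ler_peMl ?ler1n// ltW.
  have := ler_wpM2l (ltW L0) ku; have := ler_wpM2l (le_trans ler01 nL) Xe.
  lra.
- rewrite -/u -qE; set a := ((1 + delta) * q)^-1 in a0 *.
  have lq0 : (1 + delta) * q != 0 by rewrite mulf_neq0 ?gt_eqF.
  have taE : (1 + delta) * n%:R * q * (a ^+ 2 * k%:R + u) =
      n%:R * (a * k%:R) + (1 + delta) * q * (n%:R * u).
    have aE : (1 + delta) * q * a = 1 by rewrite mulfV.
    have -> : (1 + delta) * n%:R * q * (a ^+ 2 * k%:R + u) =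
      (1 + delta) * q * a * (n%:R * (a * k%:R)) + (1 + delta) * q * (n%:R * u).
      by ring.
    by rewrite aE mul1r.
  have ak : (delta + 4 * ep) * (n%:R * q) <= a * k%:R.
    apply: (@le_trans _ _ (a * (h * X))); last by rewrite ler_wpM2l ?(ltW kr).
    rewrite hE x2 /a le_eqVlt; apply/orP; left; apply/eqP; field.
    by rewrite !gt_eqF.
  have u2 : (1 - 2 * sigma) * n%:R <= 2 * u - n%:R by lra.
  rewrite taE.
  have b1 : (delta + 4 * ep) * (n%:R * q) * ((1 - 2 * sigma) * n%:R) <=
      a * k%:R * (2 * u - n%:R).
    apply: ler_pM => //; rewrite mulr_ge0 ?mulr_ge0 ?(ltW q0)//; lra.
  have b2 : (1 - ep) * q * ((1 - 3 * sigma) * n%:R ^+ 2) <=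
      (1 - ep) * q * (u ^+ 2 - u).
    by rewrite ler_wpM2l// mulr_ge0 ?(ltW q0)//; lra.
  have b3 : (1 + delta) * q * (n%:R * u) <= (1 + delta) * (q * n%:R ^+ 2).
    rewrite -mulrA ler_wpM2l ?(ltW l0)// ler_wpM2l ?(ltW q0)// expr2.
    by rewrite ler_wpM2l.
  (* By the choice of [sigma], the net gain [3 ep] equals [3 sigma (1 + delta + 4 ep)], which
     exceeds the losses [sigma (3 + 2 delta + 5 ep)]. *)
  have b4 : 1 + delta <=
      (delta + 4 * ep) * (1 - 2 * sigma) + (1 - ep) * (1 - 3 * sigma).
    have : 0 <= sigma * delta by rewrite mulr_ge0 ?(ltW s0) ?(ltW d0).
    have : 0 <= sigma * ep by rewrite mulr_ge0 ?(ltW s0) ?(ltW ep0).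
    lra.
  have qn0 : 0 <= q * n%:R ^+ 2 by rewrite mulr_ge0 ?sqr_ge0 ?(ltW q0).
  have := ler_wpM2r qn0 b4; lra.
Qed.

Lemma near_neg_ln_ge (R : realType) (p : nat -> R) (M : R) :
  (forall n, 0 < p n < 1) -> p n @[n --> \oo] --> (0 : R) ->
  \forall n \near \oo, M <= - ln (p n).
Proof.
move=> p01 p0; near=> n.
have /andP[pn0 _] := p01 n.
rewrite lerNr -[leRHS]expRK ler_ln ?posrE ?expR_gt0//.
by near: n; apply: cvgr_le p0 _ (expR_gt0 _).
Unshelve. all: by end_near. Qed.

Lemma log_ratio_bounds (R : realType) (P W c d e : R) :
  0 < W -> expR (- (W * (d + e))) <= P -> P <= expR (- (W * (c - e))) ->
  c - e <= - ln P / W <= d + e.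
Proof.
move=> W0 lP uP.
have P0 : 0 < P by apply: lt_le_trans lP; exact: expR_gt0.
rewrite ler_pdivlMr// ler_pdivrMr// lerNr lerNl; apply/andP; split.
  by rewrite -[leRHS]expRK ler_ln ?posrE ?expR_gt0// mulrC.
by rewrite -[leLHS]expRK ler_ln ?posrE ?expR_gt0// mulrC.
Qed.

Theorem theorem1p2 (R : realType) (delta : R) (p : nat -> R)
    (delta_gt0 : 0 < delta)
    (p01 : forall n : nat, 0 < p n < 1)
    (p_cvg0 : p n @[n --> \oo] --> (0 : R))
    (sqrtnp_cvgy : (Num.sqrt n%:R * p n) @[n --> \oo] --> +oo) :
  (- ln (Gnp_prob (p n)
           (fun G : graph n =>
              (1 + delta) * n%:R * p n <= lambda1 (adjacency R G)))
     / (n%:R ^+ 2 * p n ^+ 2 * ln (1 / p n))) @[n --> \oo]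
  --> Num.min ((1 + delta) ^+ 2 / 2) (delta * (1 + delta)).
Proof.
set c1 := (1 + delta) ^+ 2 / 2; set c2 := delta * (1 + delta).
set c := Num.min c1 c2.
have c1_gt0 : 0 < c1 by rewrite divr_gt0// exprn_gt0//; lra.
have c2_gt0 : 0 < c2 by rewrite mulr_gt0//; lra.
have c_gt0 : 0 < c by rewrite lt_min c1_gt0.
have cc1 : c <= c1 by rewrite ge_min lexx.
have cc2 : c <= c2 by rewrite ge_min lexx orbT.
have ln_large M := near_neg_ln_ge M p01 p_cvg0.
have x_large M : \forall n \near \oo, M <= Num.sqrt n%:R * p n.
  exact: (cvgryPge _).1 sqrtnp_cvgy M.
have p_small M : 0 < M -> \forall n \near \oo, p n <= M.
  exact: cvgr_le p_cvg0 M.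
apply/cvgrPdist_le => e0 e0_gt0.
(* The cap at 1 serves the hub estimate, where it keeps [ep] at most [1 / 8]. *)
pose e := Num.min e0 1.
have e_gt0 : 0 < e by rewrite lt_min e0_gt0 ltr01.
have e_le1 : e <= 1 by rewrite ge_min lexx orbT.
have ee0 : e <= e0 by rewrite ge_min lexx.
clearbody e.
have l0 : 0 < 1 + delta by lra.
have Y0 : 0 < 2 * (1 + delta) by rewrite mulr_gt0.
(* Up to [grid0], these facts give the positivity of the thresholds below which [p n] must
   eventually fall. They do not involve [n] and are spelled out as the three estimates require
   them. *)
have clique0 : 0 < 1 / (2 * (1 + delta)) by rewrite divr_gt0.
have h0 : 0 < 2 * (delta * (1 + delta) + e / 2).
  by rewrite mulr_gt0// addr_gt0// divr_gt0.
have hub0 : 0 < e / (8 * (1 + delta)) /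
    (1 + delta + 4 * (e / (8 * (1 + delta)))) /
    (2 * (delta * (1 + delta) + e / 2)).
  have ep0 : 0 < e / (8 * (1 + delta)) by rewrite divr_gt0 ?mulr_gt0.
  apply: divr_gt0 => //.
  exact: divr_gt0 ep0 (addr_gt0 l0 (mulr_gt0 (ltr0n _ 4) ep0)).
have grid0 : 0 < e / 8 / (2 * (1 + delta) *
    (1 + (e / (8 * (2 * (1 + delta))))^-1) /
    Num.min 1 (Num.min (4 * (2 * (1 + delta)))^-1
      (e / (128 * (2 * (1 + delta)) ^+ 3))) ^+ 2).
  have eta0 : 0 < (e / (8 * (2 * (1 + delta))))^-1.
    by rewrite invr_gt0 divr_gt0 ?(mulr_gt0 _ Y0).
  apply: divr_gt0; first by rewrite divr_gt0.
  apply: divr_gt0; first by rewrite (mulr_gt0 Y0)// addr_gt0.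
  rewrite exprn_gt0// !lt_min ltr01 invr_gt0 (mulr_gt0 _ Y0)//=.
  by rewrite divr_gt0// mulr_gt0 ?(exprn_gt0 _ Y0).
near=> n.
have /andP[pn0 pn1] := p01 n.
pose L := - ln (p n).
have pE : p n = expR (- L) by rewrite opprK lnK.
have L1 : 1 <= L by rewrite /L; near: n; exact: ln_large.
have L0 : 0 < L by lra.
have x1 : 1 <= Num.sqrt n%:R * p n by near: n; exact: x_large.
have [n0 _ _ _] := sqrt_scale pn0 pn1 erefl x1.
have -> : ln (1 / p n) = L by rewrite div1r lnV.
set P := Gnp_prob _ _; set W := n%:R ^+ 2 * p n ^+ 2 * L.
have W0 : 0 < W by rewrite !mulr_gt0 ?exprn_gt0 ?ltr0n.
have uP : P <= expR (- (W * (c - e))).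
  apply: (lambda1_upper_tail_le delta_gt0 c_gt0 cc1 cc2 e_gt0 pE erefl).
  - by rewrite /L; near: n; exact: ln_large.
  - by rewrite /L; near: n; exact: ln_large.
  - near: n; exact: (p_small _ grid0).
  - exact: x1.
  - by near: n; exact: x_large.
  - by near: n; exact: x_large.
have lP1 : expR (- (W * (c1 + e))) <= P.
  apply: (lambda1_upper_tail_ge_clique delta_gt0 e_gt0 L0 pE erefl).
  - by rewrite -ler_pdivlMr//; near: n; exact: p_small.
  - by near: n; exact: x_large.
  - by near: n; exact: x_large.
have lP2 : expR (- (W * (c2 + e))) <= P.
  apply: (lambda1_upper_tail_ge_hub delta_gt0 e_gt0 e_le1 L1 pE erefl).
  - by rewrite -ler_pdivlMr//; near: n; exact: p_small.
  - by near: n; exact: x_large.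
  - by near: n; exact: x_large.
  - by near: n; exact: x_large.
have lP : expR (- (W * (c + e))) <= P.
  by rewrite /c; case: (leP c1 c2).
have /andP[h1 h2] := log_ratio_bounds W0 lP uP.
rewrite distrC ler_distl; apply/andP; split; lra.
Unshelve. all: by end_near. Qed.
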